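(* Let $L,M\subset\mathfrak l$ be finitely generated $R$-submodules. Then $\mathbb G^\bullet[L;M]$ is the minimal subgroup of finite index in $\widehat{\mathbb G}[L;M]$: it has finite index in $\widehat{\mathbb G}[L;M]$, and it is contained in every subgroup of finite index in $\widehat{\mathbb G}[L;M]$.
   Context: Let $p>2$ be a prime, $\mu\ge 1$, $R:=\mathbb Z/p^\mu\mathbb Z$. Let $\mathfrak l$ be the $R$-module of all sequences (row vectors) $v=(v_1,v_2,\dots)$, $v_j\in R$, with $v_j=0$ for all sufficiently large $j$; $R^m\subset\mathfrak l$ denotes the sequences supported in the first $m$ coordinates. $\mathbb G=\mathrm{GL}(\infty,R)$ is the group of all infinite invertible matrices $g$ over $R$ (indexed by $\mathbb N$) such that each row and each column of $g$ and of $g^{-1}$ contains only finitely many nonzero elements. For finitely generated submodules $L,M\subset\mathfrak l$, $\widehat{\mathbb G}[L;M]$ is the subgroup of all $g\in\mathbb G$ with $Lg=L$ and $M(g^t)^{-1}=M$. Definition of $\mathbb G^\bullet[L;M]$: choose $m$ with $L,M\subset R^m$. For a matrix $B$ with $k$ rows put $\ker B=\{v\in R^k: vB=0\}$. Choose, for some $N$, an $m\times N$ matrix $b$ with $\ker b=L$ and an $N\times m$ matrix $c$ with $\ker c^t=M$. Then $\mathbb G^\bullet[L;M]$ is the group of all $g\in\mathbb G$ which, as block matrices of size $m+\infty$, can be written in the form $$g=\begin{pmatrix}1-buc& bv\\ wc& z\end{pmatrix}$$ for some matrices $u,v,w,z$ (of sizes $N\times N$, $N\times\infty$, $\infty\times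 N$, $\infty\times\infty$). This is a subgroup of $\widehat{\mathbb G}[L;M]$ not depending on the choice of $m,b,c$. *)

(* Defs.v *)
From HB Require Import structures.
From mathcomp Require Import all_boot all_order all_algebra.
From mathcomp Require Import mathcomp_extra boolp classical_sets functions.
From mathcomp Require Import cardinality fsbigop.

Set Implicit Arguments.
Unset Strict Implicit.
Unset Printing Implicit Defensive.

Import GRing.Theory.

Local Open Scope classical_set_scope.
Local Open Scope ring_scope.

Definition infseq (R : Type) := nat -> R.

Definition infmx (R : Type) := nat -> nat -> R.

Section InfiniteMatrices.
Variable R : comNzRingType.
Implicit Types (A B C : infmx R) (v : infseq R).

Definition finsupp v := finite_set [set j | v j != 0].

Definition rcfinite A :=
  (forall i, finsupp (A i)) /\ (forall j, finsupp (fun i => A i j)).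

(* [\sum_(k \in setT)] is the sum over the support, and 0 when the support is
   infinite; the latter case never occurs for row-finite [A] below. *)
Definition mulimx A B : infmx R := fun i j => \sum_(k \in setT) A i k * B k j.

Definition mulivmx v A : infseq R := fun j => \sum_(i \in setT) v i * A i j.

Definition imx1 : infmx R := fun i j => (i == j)%:R.

Definition trimx A : infmx R := fun i j => A j i.

Lemma finsupp_bound v :
  finsupp v -> exists n, forall k, (n <= k)%N -> v k = 0.
Proof.
move=> /finite_seqP[s sE]; exists (\max_(k <- s) k).+1 => k lek.
apply/eqP/negPn/negP => vk.
have : [set j | v j != 0] k by [].
rewrite sE /= => ks.
have := @leq_bigmax_seq _ s xpredT id k ks isT.
by move=> /leq_ltn_trans/(_ lek); rewrite ltnn.
Qed.

Lemma bound_finsupp n v : (forall k, (n <= k)%N -> v k = 0) -> finsupp v.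
Proof.
move=> v0; apply: (@sub_finite_set _ _ `I_n); last exact: finite_II.
by move=> k /= /eqP vk; rewrite ltnNge; apply/negP => /v0.
Qed.

Lemma fsum_ord n v :
  (forall k, (n <= k)%N -> v k = 0) -> \sum_(k \in setT) v k = \sum_(k < n) v k.
Proof.
move=> v0; rewrite (fsbig_ord _ n v); apply/esym/fsbig_widen => // k [_ /=].
by move/negP; rewrite -leqNgt => /v0.
Qed.

Lemma rcfinite_tr A : rcfinite A -> rcfinite (trimx A).
Proof. by case. Qed.

Lemma trimx_mul A B : trimx (mulimx A B) = mulimx (trimx B) (trimx A).
Proof.
apply/funext => i; apply/funext => j; rewrite /trimx /mulimx.
by apply: eq_fsbigr => k _; rewrite mulrC.
Qed.

Lemma trimx1 : trimx imx1 = imx1.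
Proof. by apply/funext => i; apply/funext => j; rewrite /trimx /imx1 eq_sym. Qed.

Lemma rcfinite1 : rcfinite imx1.
Proof.
split=> i; apply: (@bound_finsupp i.+1) => k ik.
  by rewrite /imx1 ltn_eqF.
by rewrite /imx1 gtn_eqF.
Qed.

Lemma mul1imx A : mulimx imx1 A = A.
Proof.
apply/funext => i; apply/funext => j; rewrite /mulimx.
rewrite (@fsum_ord i.+1) => [|k ik]; last by rewrite /imx1 ltn_eqF ?mul0r.
rewrite (bigD1 ord_max) //= /imx1 eqxx mul1r big1 ?addr0 // => k kn.
by rewrite eq_sym (_ : (k : nat) == i = false) ?mul0r //; exact/negbTE.
Qed.

Lemma mulimx1 A : mulimx A imx1 = A.
Proof.
by rewrite -[LHS]/(trimx (trimx _)) trimx_mul trimx1 mul1imx.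
Qed.

Lemma mulimx_row A B i : rcfinite A -> rcfinite B -> finsupp (mulimx A B i).
Proof.
move=> [rA _] [rB _]; have [n An] := finsupp_bound (rA i).
have /choice[b Bb] : forall k, exists n, forall j, (n <= j)%N -> B k j = 0.
  by move=> k; exact: finsupp_bound (rB k).
apply: (@bound_finsupp (\max_(k < n) b k)) => j bj; rewrite /mulimx.
rewrite (@fsum_ord n) => [|k nk]; last by rewrite An ?mul0r.
rewrite big1 // => k _; rewrite Bb ?mulr0 //.
exact: leq_trans (leq_bigmax k) bj.
Qed.

Lemma rcfinite_mul A B : rcfinite A -> rcfinite B -> rcfinite (mulimx A B).
Proof.
move=> fA fB; split=> i; first exact: mulimx_row.
rewrite -[X in finsupp X]/(trimx (mulimx A B) i) trimx_mul.
by apply: mulimx_row; apply: rcfinite_tr.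
Qed.

Lemma mulimxA A B C : rcfinite A -> rcfinite C ->
  mulimx A (mulimx B C) = mulimx (mulimx A B) C.
Proof.
move=> [rA _] [_ cC]; apply/funext => i; apply/funext => j.
have [n An] := finsupp_bound (rA i); have [m Cm] := finsupp_bound (cC j).
rewrite /mulimx (@fsum_ord n) => [|k nk]; last by rewrite An ?mul0r.
rewrite [RHS](@fsum_ord m) => [|k mk]; last by rewrite Cm ?mulr0.
transitivity (\sum_(k < n) \sum_(l < m) A i k * B k l * C l j).
  apply: eq_bigr => k _; rewrite (@fsum_ord m) ?big_distrr /=.
    by apply: eq_bigr => l _; rewrite mulrA.
  by move=> l ml; rewrite Cm ?mulr0.
rewrite exchange_big; apply: eq_bigr => l _ /=.
rewrite (@fsum_ord n) ?big_distrl // => k nk.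
by rewrite An ?mul0r.
Qed.

End InfiniteMatrices.

Arguments imx1 {R}.

(* The inverse is stored together with the matrix; being unique, it adds no
   information (see [GLinf_inj]). *)
Record GLinf (R : comNzRingType) := MkGLinf {
  glmx :> infmx R;
  glinv : infmx R;
  glmx_rcfinite : rcfinite glmx;
  glinv_rcfinite : rcfinite glinv;
  glmxV : mulimx glmx glinv = imx1;
  glVmx : mulimx glinv glmx = imx1 }.

Section GLinfGroup.
Variable R : comNzRingType.
Implicit Types g h : GLinf R.

Lemma GLinf_inj : injective (@glmx R).
Proof.
move=> [a a' fa fa' aa' a'a] [b b' fb fb' bb' b'b] /= E.
subst b; have E : a' = b'.
  by rewrite -[a']mulimx1 -bb' mulimxA // a'a mul1imx.
subst b'; congr MkGLinf; exact: Prop_irrelevance.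
Qed.

Definition GLone : GLinf R :=
  MkGLinf (rcfinite1 R) (rcfinite1 R) (mul1imx _) (mul1imx _).

Definition GLinv g : GLinf R :=
  MkGLinf (glinv_rcfinite g) (glmx_rcfinite g) (glVmx g) (glmxV g).

Lemma GLmul_proof g h :
  mulimx (mulimx g h) (mulimx (glinv h) (glinv g)) = imx1.
Proof.
have [fg fh] := (glmx_rcfinite g, glmx_rcfinite h).
have [fg' fh'] := (glinv_rcfinite g, glinv_rcfinite h).
rewrite -mulimxA //; last exact: rcfinite_mul.
by rewrite [X in mulimx g X]mulimxA // glmxV mul1imx glmxV.
Qed.

Definition GLmul g h : GLinf R :=
  MkGLinf (rcfinite_mul (glmx_rcfinite g) (glmx_rcfinite h))
          (rcfinite_mul (glinv_rcfinite h) (glinv_rcfinite g))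
          (GLmul_proof g h) (GLmul_proof (GLinv h) (GLinv g)).

Lemma GLtr_proof (a b : infmx R) :
  mulimx a b = imx1 -> mulimx (trimx b) (trimx a) = imx1.
Proof. by move=> ab; rewrite -trimx_mul ab trimx1. Qed.

Definition GLtr g : GLinf R :=
  MkGLinf (rcfinite_tr (glmx_rcfinite g)) (rcfinite_tr (glinv_rcfinite g))
          (GLtr_proof (glVmx g)) (GLtr_proof (glmxV g)).

HB.instance Definition _ := gen_eqMixin (GLinf R).
HB.instance Definition _ := gen_choiceMixin (GLinf R).

Lemma GLmulA : associative GLmul.
Proof.
by move=> g h k; apply: GLinf_inj; apply: mulimxA; apply: glmx_rcfinite.
Qed.
Lemma GLmul1g : left_id GLone GLmul.
Proof. by move=> g; apply: GLinf_inj; apply: mul1imx. Qed.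
Lemma GLmulg1 : right_id GLone GLmul.
Proof. by move=> g; apply: GLinf_inj; apply: mulimx1. Qed.
Lemma GLmulVg : left_inverse GLone GLinv GLmul.
Proof. by move=> g; apply: GLinf_inj; apply: glVmx. Qed.
Lemma GLmulgV : right_inverse GLone GLinv GLmul.
Proof. by move=> g; apply: GLinf_inj; apply: glmxV. Qed.

HB.instance Definition _ :=
  isGroup.Build (GLinf R) GLmulA GLmul1g GLmulg1 GLmulVg GLmulgV.

End GLinfGroup.

Section Subgroups.
Variable G : groupType.
Implicit Types H K : set G.

Definition is_subgroup H :=
  [/\ H 1%g, (forall x y, H x -> H y -> H (x * y)%g)
    & forall x, H x -> H (x^-1)%g].

Definition left_coset H x : set G := [set (x * h)%g | h in H].

Definition finite_index_subgroup H K :=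
  [/\ is_subgroup H, H `<=` K & finite_set [set left_coset H x | x in K]].

Definition minimal_finite_index_subgroup H K :=
  finite_index_subgroup H K /\
  forall H', finite_index_subgroup H' K -> H `<=` H'.

End Subgroups.

Section HatAndBullet.
Variable R : comNzRingType.
Implicit Types L M : set (infseq R).

Definition fg_submodule L := exists (n : nat) (e : 'I_n -> infseq R),
  (forall i, finsupp (e i)) /\
  L = [set v | exists a : 'I_n -> R, v = fun j => \sum_i a i * e i j].

Definition Ghat L M : set (GLinf R) := [set g : GLinf R |
  [set mulivmx v g | v in L] = L /\
  [set mulivmx v ((GLtr g)^-1)%g | v in M] = M].

(* The inclusion of R^m in the module of finitely supported sequences. *)
Definition rv_infseq m (v : 'rV[R]_m) : infseq R :=
  fun j => if insub j is Some j' then v 0 j' else 0.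

Definition ker_infseq m N (B : 'M[R]_(m, N)) : set (infseq R) :=
  [set rv_infseq v | v in [set v : 'rV[R]_m | v *m B = 0]].

(* The matrix / A B \ of size m + oo.
             \ C D /                   *)
Definition block_infmx m (A : 'M[R]_m) (B : 'I_m -> nat -> R)
    (C : nat -> 'I_m -> R) (D : infmx R) : infmx R :=
  fun i j => match insub i, insub j with
    | Some i', Some j' => A i' j'
    | Some i', None => B i' (j - m)%N
    | None, Some j' => C (i - m)%N j'
    | None, None => D (i - m)%N (j - m)%N
    end.

Definition Gbullet_form m N (b : 'M[R]_(m, N)) (c : 'M[R]_(N, m)) :
    set (GLinf R) :=
  [set g | exists (u : 'M[R]_N) (v : 'I_N -> nat -> R) (w : nat -> 'I_N -> R)
                  (z : infmx R),
    glmx g = block_infmx (1%:M - b *m u *m c)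
                         (fun i j => \sum_k b i k * v k j)
                         (fun i j => \sum_k w i k * c k j)
                         z].

(* The kernel conditions force L and M to lie in R^m.  The set
   [Gbullet_form b c] is the same for all admissible (m, N, b, c), so taking
   the union amounts to choosing one of them. *)
Definition Gbullet L M : set (GLinf R) :=
  [set g | exists (m N : nat) (b : 'M[R]_(m, N)) (c : 'M[R]_(N, m)),
    [/\ ker_infseq b = L, ker_infseq (c^T) = M & Gbullet_form b c g]].

End HatAndBullet.

(* Main.v *)
(** Choose [b] and [c] as in the definition of G^bullet[L;M]. By self-injectivity
    of Z/n, the columns of diag(b, 1) generate the annihilator of L, and likewise
    for c and M, so G^bullet consists of the invertible [1 + X Y] with [L X = 0]
    and [Y M^t = 0]. For [g] and [h] in the stabilizer, [h - g] is annihilated by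
    [L] and [M]; when [g] and [h] have the same m x m corner it follows that
    [h - g = diag(b, 1) U diag(c, 1)], hence [g^-1 h] lies in G^bullet: the corner
    takes finitely many values, which bounds the index.

    Conversely let [N] be a normal subgroup of finite index. By the pigeonhole
    principle and a shift (swindle), [N] contains every matrix that acts on a
    subset of the indices beyond [m] with infinite complement beyond [m]. Since 2
    is invertible, commutators with [diag(1, 2)] put the unipotent matrices
    [1 + X e] and [1 + e^t Y] into [N]. Multiplying [g] in G^bullet by involutions
    that exchange a sparse set of basis vectors with their images, one may assume
    that [g] is the identity on an infinite set of indices; Whitehead's
    factorization of [(1 + X Y) (+) (1 + Y X)^-1] then uses this room to write [g]
    with matrices of the two former kinds. *)
From HB Require Import structures.
Require Import Defs.
From mathcomp Require Import all_boot all_order all_algebra.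
From mathcomp Require Import mathcomp_extra boolp classical_sets functions.
From mathcomp Require Import cardinality fsbigop.
From mathcomp Require Import zify.

Set Implicit Arguments.
Unset Strict Implicit.
Unset Printing Implicit Defensive.

Import Order.TTheory GRing.Theory Num.Theory.
Local Open Scope classical_set_scope.
Local Open Scope ring_scope.

(** * Row- and column-finite matrices *)

Section FiniteSupport.
Variables (R : comNzRingType).

(** An explicit list bounding the support turns sums over [setT] into sums over duplicate-free
    lists, for any index type. *)
Definition fsupp (J : choiceType) (v : J -> R) :=
  exists s : seq J, forall j, j \notin s -> v j = 0.

Lemma fsuppW (J : choiceType) (v : J -> R) : fsupp v ->
  exists2 s : seq J, uniq s & forall j, j \notin s -> v j = 0.
Proof.
move=> [s sP]; exists (undup s); first exact: undup_uniq.
by move=> j; rewrite mem_undup; apply: sP.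
Qed.

Lemma fsuppP (v : infseq R) : finsupp v <-> fsupp v.
Proof.
split=> [/finsupp_bound[n nP]|[s sP]].
  by exists (iota 0 n) => j; rewrite mem_iota /= add0n -leqNgt => /nP.
apply: (@bound_finsupp _ (\max_(k <- s) k).+1) => k lek; apply: sP.
apply/negP => ks; have := @leq_bigmax_seq _ s xpredT id k ks isT.
by move=> /leq_ltn_trans/(_ lek); rewrite ltnn.
Qed.

Lemma fsum_seq (J : choiceType) (s : seq J) (v : J -> R) : uniq s ->
  (forall j, j \notin s -> v j = 0) -> \sum_(j \in setT) v j = \sum_(j <- s) v j.
Proof.
move=> us v0; rewrite (@fsbig_seq _ _ _ _ s v us); apply/esym/fsbig_widen => // j [_ /=].
by move/negP/v0.
Qed.

Lemma fsuppD (J : choiceType) (v w : J -> R) :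
  fsupp v -> fsupp w -> fsupp (fun j => v j + w j).
Proof.
move=> [s sP] [t tP]; exists (s ++ t) => j; rewrite mem_cat negb_or => /andP[js jt].
by rewrite sP ?tP ?addr0.
Qed.

Lemma fsuppN (J : choiceType) (v : J -> R) : fsupp v -> fsupp (fun j => - v j).
Proof. by move=> [s sP]; exists s => j /sP ->; rewrite oppr0. Qed.

Lemma fsupp0 (J : choiceType) : fsupp (fun _ : J => 0).
Proof. by exists [::]. Qed.

End FiniteSupport.

(* Row- and column-finite matrices over arbitrary index types form a category
   with transposition, in which the manipulations of block matrices below
   become algebraic identities. *)
Record rcmx (R : comNzRingType) (I J : choiceType) := Rcmx {
  rcval :> I -> J -> R;
  rc_row : forall i, fsupp (rcval i);
  rc_col : forall j, fsupp (fun i => rcval i j) }.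

Section RcmxZmod.
Variables (R : comNzRingType) (I J : choiceType).
Implicit Types A B : rcmx R I J.

Lemma rcmxP A B : (forall i j, A i j = B i j) -> A = B.
Proof.
case: A B => [a a1 a2] [b b1 b2] /= ab; have E : a = b.
  by apply/funext => i; apply/funext => j.
by subst b; congr Rcmx; exact: Prop_irrelevance.
Qed.

HB.instance Definition _ := gen_eqMixin (rcmx R I J).
HB.instance Definition _ := gen_choiceMixin (rcmx R I J).

Definition radd A B : rcmx R I J :=
  @Rcmx R I J (fun i j => A i j + B i j)
    (fun i => fsuppD (rc_row A i) (rc_row B i))
    (fun j => fsuppD (rc_col A j) (rc_col B j)).
Definition ropp A : rcmx R I J :=
  @Rcmx R I J (fun i j => - A i j)
    (fun i => fsuppN (rc_row A i)) (fun j => fsuppN (rc_col A j)).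
Definition rzero : rcmx R I J :=
  @Rcmx R I J (fun _ _ => 0) (fun _ => fsupp0 _ _) (fun _ => fsupp0 _ _).

Lemma raddA : associative radd.
Proof. by move=> A B C; apply: rcmxP => i j /=; rewrite addrA. Qed.
Lemma raddC : commutative radd.
Proof. by move=> A B; apply: rcmxP => i j /=; rewrite addrC. Qed.
Lemma radd0 : left_id rzero radd.
Proof. by move=> A; apply: rcmxP => i j /=; rewrite add0r. Qed.
Lemma raddN : left_inverse rzero ropp radd.
Proof. by move=> A; apply: rcmxP => i j /=; rewrite addNr. Qed.

HB.instance Definition _ :=
  GRing.isZmodule.Build (rcmx R I J) raddA raddC radd0 raddN.

Lemma rcD A B i j : (A + B) i j = A i j + B i j. Proof. by []. Qed.
Lemma rcB A B i j : (A - B) i j = A i j - B i j. Proof. by []. Qed.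
Lemma rc0 i j : (0 : rcmx R I J) i j = 0. Proof. by []. Qed.

End RcmxZmod.

Definition rtr (R : comNzRingType) (I J : choiceType) (A : rcmx R I J) :=
  @Rcmx R J I (fun i j => A j i) (rc_col A) (rc_row A).

Section RcmxMul.
Variable R : comNzRingType.
Implicit Types I J K L : choiceType.

Definition rmulf I J K (A : rcmx R I J) (B : rcmx R J K) i k :=
  \sum_(j \in setT) A i j * B j k.

Lemma rmulf_seq I J K (A : rcmx R I J) (B : rcmx R J K) i k (s : seq J) :
  uniq s -> (forall j, j \notin s -> A i j = 0) ->
  rmulf A B i k = \sum_(j <- s) A i j * B j k.
Proof. by move=> us As; apply: fsum_seq => // j /As ->; rewrite mul0r. Qed.

Lemma rmulf_seqr I J K (A : rcmx R I J) (B : rcmx R J K) i k (s : seq J) :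
  uniq s -> (forall j, j \notin s -> B j k = 0) ->
  rmulf A B i k = \sum_(j <- s) A i j * B j k.
Proof. by move=> us Bs; apply: fsum_seq => // j /Bs ->; rewrite mulr0. Qed.

Lemma rmulf_row I J K (A : rcmx R I J) (B : rcmx R J K) i : fsupp (rmulf A B i).
Proof.
have [s us sP] := fsuppW (rc_row A i).
have /choice[t tP] : forall j, exists t : seq K, forall k, k \notin t -> B j k = 0.
  by move=> j; exact: rc_row.
exists (flatten (map t s)) => k kt; rewrite (rmulf_seq _ _ us sP) big_seq big1 // => j js.
rewrite tP ?mulr0 //; apply: contra kt => kt.
by apply/flattenP; exists (t j) => //; apply: map_f.
Qed.

Lemma rmulf_tr I J K (A : rcmx R I J) (B : rcmx R J K) i k :
  rmulf A B i k = rmulf (rtr B) (rtr A) k i.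
Proof. by apply: eq_fsbigr => j _; rewrite mulrC. Qed.

Lemma rmulf_col I J K (A : rcmx R I J) (B : rcmx R J K) k :
  fsupp (fun i => rmulf A B i k).
Proof.
have [s sP] := rmulf_row (rtr B) (rtr A) k; exists s => i /sP.
by rewrite -rmulf_tr.
Qed.

Definition rmul I J K A B := Rcmx (@rmulf_row I J K A B) (rmulf_col A B).
Local Notation "A ** B" := (rmul A B) (at level 40, left associativity).

Lemma rmulE I J K (A : rcmx R I J) (B : rcmx R J K) i k :
  (A ** B) i k = \sum_(j \in setT) A i j * B j k.
Proof. by []. Qed.

Lemma rmul_seq I J K (A : rcmx R I J) (B : rcmx R J K) i k (s : seq J) :
  uniq s -> (forall j, j \notin s -> A i j = 0) ->
  (A ** B) i k = \sum_(j <- s) A i j * B j k.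
Proof. exact: rmulf_seq. Qed.

Lemma rmul_seqr I J K (A : rcmx R I J) (B : rcmx R J K) i k (s : seq J) :
  uniq s -> (forall j, j \notin s -> B j k = 0) ->
  (A ** B) i k = \sum_(j <- s) A i j * B j k.
Proof. exact: rmulf_seqr. Qed.

Lemma rtr_mul I J K (A : rcmx R I J) (B : rcmx R J K) :
  rtr (A ** B) = rtr B ** rtr A.
Proof. by apply: rcmxP => i k /=; rewrite rmulf_tr. Qed.

Lemma rtrK I J (A : rcmx R I J) : rtr (rtr A) = A.
Proof. exact: rcmxP. Qed.
Lemma rtrD I J (A B : rcmx R I J) : rtr (A + B) = rtr A + rtr B.
Proof. exact: rcmxP. Qed.
Lemma rtrN I J (A : rcmx R I J) : rtr (- A) = - rtr A.
Proof. exact: rcmxP. Qed.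
Lemma rmulA I J K L (A : rcmx R I J) (B : rcmx R J K) (C : rcmx R K L) :
  A ** (B ** C) = A ** B ** C.
Proof.
apply: rcmxP => i l /=.
have [s us sP] := fsuppW (rc_row A i); have [t ut tP] := fsuppW (rc_col C l).
rewrite (rmulf_seq _ _ us sP) (rmulf_seqr _ _ ut tP).
transitivity (\sum_(j <- s) \sum_(k <- t) A i j * B j k * C k l).
  apply: eq_bigr => j _ /=; rewrite (rmulf_seqr _ _ ut tP) big_distrr /=.
  by apply: eq_bigr => k _; rewrite mulrA.
rewrite exchange_big; apply: eq_bigr => k _ /=.
by rewrite (rmulf_seq _ _ us sP) big_distrl.
Qed.

Lemma rmulDr I J K (A : rcmx R I J) (B C : rcmx R J K) :
  A ** (B + C) = A ** B + A ** C.
Proof.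
apply: rcmxP => i k; have [s us sP] := fsuppW (rc_row A i).
rewrite rcD !(rmul_seq _ _ us sP) -big_split /=.
by apply: eq_bigr => j _; rewrite mulrDr.
Qed.

Lemma rmulDl I J K (A B : rcmx R I J) (C : rcmx R J K) :
  (A + B) ** C = A ** C + B ** C.
Proof. by rewrite -[LHS]rtrK rtr_mul rtrD rmulDr rtrD !rtr_mul !rtrK. Qed.

Lemma rmul0 I J K (A : rcmx R I J) : A ** (0 : rcmx R J K) = 0.
Proof. by apply: (addrI (A ** 0)); rewrite -rmulDr !addr0. Qed.
Lemma rmul0l I J K (A : rcmx R J K) : (0 : rcmx R I J) ** A = 0.
Proof. by apply: (addrI (0 ** A)); rewrite -rmulDl !addr0. Qed.
Lemma rmulNr I J K (A : rcmx R I J) (B : rcmx R J K) : A ** (- B) = - (A ** B).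
Proof. by apply: (addrI (A ** B)); rewrite -rmulDr !subrr rmul0. Qed.
Lemma rmulNl I J K (A : rcmx R I J) (B : rcmx R J K) : (- A) ** B = - (A ** B).
Proof. by apply: (addrI (A ** B)); rewrite -rmulDl !subrr rmul0l. Qed.
Lemma rmulBr I J K (A : rcmx R I J) (B C : rcmx R J K) :
  A ** (B - C) = A ** B - A ** C.
Proof. by rewrite rmulDr rmulNr. Qed.
Lemma rmulBl I J K (A B : rcmx R I J) (C : rcmx R J K) :
  (A - B) ** C = A ** C - B ** C.
Proof. by rewrite rmulDl rmulNl. Qed.

Lemma sub_mx_row I J (f : I -> J) (i : I) : fsupp (fun j => (f i == j)%:R : R).
Proof. by exists [:: f i] => j; rewrite inE eq_sym => /negbTE->. Qed.

Lemma sub_mx_col I J (f : I -> J) : injective f ->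
  forall j, fsupp (fun i => (f i == j)%:R : R).
Proof.
move=> fI j; have [[i fij]|nf] := pselect (exists i, f i = j).
  by exists [:: i] => i'; rewrite inE -(inj_eq fI) fij => /negbTE ->.
by exists [::] => i _; case: eqP => // fij; case: nf; exists i.
Qed.

(* The rows of [injmx] are the basis vectors selected by an injection, so it
   is a coisometry: [injmx ** rtr injmx = 1]. *)
Definition injmx I J (f : I -> J) (fI : injective f) : rcmx R I J :=
  Rcmx (sub_mx_row f) (sub_mx_col fI).

Definition rone I : rcmx R I I := injmx (@inj_id I).

Lemma roneE I (i j : I) : rone I i j = (i == j)%:R. Proof. by []. Qed.

Lemma injmx_mul I J K (f : I -> J) (fI : injective f) (A : rcmx R J K) i k :
  (injmx fI ** A) i k = A (f i) k.
Proof.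
rewrite (@rmul_seq _ _ _ _ _ _ _ [:: f i]) // => [|j].
  by rewrite big_seq1 /= eqxx mul1r.
by rewrite inE eq_sym /= => /negbTE ->.
Qed.

Lemma mul_injmxT I J K (f : I -> J) (fI : injective f) (A : rcmx R K J) k i :
  (A ** rtr (injmx fI)) k i = A k (f i).
Proof.
rewrite -[LHS]/(rtr (A ** rtr (injmx fI)) i k) rtr_mul rtrK.
by rewrite injmx_mul.
Qed.

Lemma rmul1l I J (A : rcmx R I J) : rone I ** A = A.
Proof. by apply: rcmxP => i j; rewrite injmx_mul. Qed.

Lemma rtr1 I : rtr (rone I) = rone I.
Proof. by apply: rcmxP => i j /=; rewrite eq_sym. Qed.

Lemma rmul1r I J (A : rcmx R I J) : A ** rone J = A.
Proof. by rewrite -rtr1; apply: rcmxP => i j; rewrite mul_injmxT. Qed.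

Lemma injmxK I J (f : I -> J) (fI : injective f) :
  injmx fI ** rtr (injmx fI) = rone I.
Proof. by apply: rcmxP => i j; rewrite injmx_mul /= eq_sym (inj_eq fI). Qed.

End RcmxMul.

Arguments rone {R I}.
Notation "A ** B" := (rmul A B) (at level 40, left associativity) : ring_scope.

(** * Block-diagonal matrices and the swindle *)

Definition rcinv (R : comNzRingType) (I : choiceType) (A A' : rcmx R I I) :=
  A ** A' = rone /\ A' ** A = rone.

Lemma rcinv_sym (R : comNzRingType) (I : choiceType) (A A' : rcmx R I I) :
  rcinv A A' -> rcinv A' A.
Proof. by case. Qed.

(* [N] stands for a normal subgroup of finite index of the group of the
   invertible matrices satisfying [S]. *)
Record small_normal (R : comNzRingType) (I : choiceType)
    (S N : rcmx R I I -> Prop) : Prop := {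
  sn_mul : forall A B, N A -> N B -> N (A ** B);
  sn_inv : forall A A', N A -> rcinv A A' -> N A';
  sn_conj : forall A B B', N A -> rcinv B B' -> S B -> N (B ** A ** B');
  sn_pigeon : forall x x' : nat -> rcmx R I I,
    (forall n, rcinv (x n) (x' n)) -> (forall n, S (x n)) ->
    exists a b, a != b /\ N (x' a ** x b) }.

Section BlockDiagonal.
Variables (R : comNzRingType) (T I : choiceType).
Implicit Types h k : T -> rcmx R I I.

Definition blkf h (i j : T * I) : R := if i.1 == j.1 then h i.1 i.2 j.2 else 0.

Lemma blk_row h i : fsupp (blkf h i).
Proof.
have [s sP] := rc_row (h i.1) i.2; exists (map (pair i.1) s) => -[t x] ts.
rewrite /blkf /=; case: eqP => // E; apply: sP; apply: contra ts => xs.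
by rewrite -E map_f.
Qed.

Lemma blk_col h j : fsupp (fun i => blkf h i j).
Proof.
have [s sP] := rc_col (h j.1) j.2; exists (map (pair j.1) s) => -[t x] ts.
rewrite /blkf /=; case: eqP => // E; subst t; apply: sP; apply: contra ts => xs.
by rewrite map_f.
Qed.

Definition blk h := Rcmx (blk_row h) (blk_col h).

Lemma blkM h k : blk h ** blk k = blk (fun t => h t ** k t).
Proof.
apply: rcmxP => -[t x] [t' y] /=.
have [s us sP] := fsuppW (rc_row (h t) x).
rewrite (@rmulf_seq _ _ _ _ _ _ _ _ (map (pair t) s)).
- rewrite big_map /= /blkf /= eqxx; case: eqP => [E|_].
    by subst t'; rewrite (rmulf_seq _ _ us sP).
  by rewrite big1 // => j _; rewrite mulr0.
- by rewrite map_inj_uniq // => a b [].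
- move=> [t'' z] zs; rewrite /= /blkf /=; case: eqP => // E; apply: sP.
  by apply: contra zs => zs; rewrite -E map_f.
Qed.

Lemma eq_blk h k : (forall t, h t = k t) -> blk h = blk k.
Proof. by move=> hk; congr blk; apply/funext. Qed.

Lemma blk1 : blk (fun=> rone) = rone.
Proof.
apply: rcmxP => -[t x] [t' y] /=; rewrite /blkf /= xpair_eqE.
by case: (t == t').
Qed.

Lemma blk_inv h h' : (forall t, rcinv (h t) (h' t)) -> rcinv (blk h) (blk h').
Proof. by move=> hh'; split; rewrite blkM -blk1; apply: eq_blk => t; case: (hh' t). Qed.

Lemma pair_inj (t : T) : injective (@pair T I t).
Proof. by move=> x y []. Qed.

Definition blk_single t0 (h : rcmx R I I) :=
  blk (fun t => if t == t0 then h else rone).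

(** Gives a single block the shape of [emb], so that the outcome of the swindle can be transported
    along an injection. *)
Lemma blk_singleE t0 (h : rcmx R I I) : blk_single t0 h =
  rone + rtr (injmx R (@pair_inj t0)) ** (h - rone) ** injmx R (@pair_inj t0).
Proof.
apply: rcmxP => -[t x] [t' y]; rewrite rcD.
set E := injmx R _; have E1 (A : rcmx R I (T * I)%type) u :
    (rtr E ** A) (u, x) (t', y) = if u == t0 then A x (t', y) else 0.
  rewrite -[LHS]/(rmul _ _ _ _); case: eqP => [->|/eqP ut].
    rewrite (@rmul_seq _ _ _ _ _ _ _ _ [:: x]) // => [|j].
      by rewrite big_seq1 /= eqxx mul1r.
    by rewrite inE /= xpair_eqE eqxx => /negbTE ->.
  rewrite (@rmul_seq _ _ _ _ _ _ _ _ [::]) ?big_nil // => j _ /=.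
  by rewrite xpair_eqE eq_sym (negbTE ut).
have E2 (A : rcmx R I I) u : (A ** E) x (u, y) = if u == t0 then A x y else 0.
  case: eqP => [->|/eqP ut].
    rewrite (@rmul_seqr _ _ _ _ _ _ _ _ [:: y]) // => [|j].
      by rewrite big_seq1 /= eqxx mulr1.
    by rewrite inE /= xpair_eqE eqxx => /negbTE ->.
  rewrite (@rmul_seqr _ _ _ _ _ _ _ _ [::]) ?big_nil // => j _ /=.
  by rewrite xpair_eqE eq_sym (negbTE ut).
rewrite -rmulA E1 E2 /= /blkf /= xpair_eqE.
case: (eqVneq t t') => [<-|tt'] /=; case: (eqVneq t t0) => [tt0|tt0] /=;
  rewrite ?addr0 // 1?addrC ?subrK //.
by rewrite -tt0 eq_sym (negbTE tt') addr0.
Qed.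

Lemma perm_inj (s : T -> T) : injective s ->
  injective (fun i : T * I => (s i.1, i.2)).
Proof. by move=> sI [t x] [t' y] /= [/sI -> ->]. Qed.

Lemma blk_perm (s s' : T -> T) (sK : cancel s s') (s'K : cancel s' s) h
    (P := injmx R (perm_inj (can_inj sK))) :
  rcinv P (rtr P) /\ P ** blk h ** rtr P = blk (h \o s).
Proof.
split; [split; first exact: injmxK|].
  have -> : rtr P = injmx R (perm_inj (can_inj s'K)).
    apply: rcmxP => -[t x] [t' y] /=; rewrite !xpair_eqE [x == y]eq_sym; congr (_ && _)%:R.
    by apply/eqP/eqP => <-; rewrite ?sK ?s'K.
  apply: rcmxP => -[t x] [t' y]; rewrite injmx_mul /=.
  by rewrite s'K.
apply: rcmxP => -[t x] [t' y]; rewrite mul_injmxT injmx_mul /= /blkf /=.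
by rewrite (can_eq sK).
Qed.

End BlockDiagonal.

(* A block repeated infinitely often, conjugated by a shift of the places,
   differs from itself by a single block; two such families of blocks that
   agree modulo [N] thus put the single block into [N]. *)
Lemma swindle (R : comNzRingType) (I : choiceType)
    (N : rcmx R (nat * int * I)%type (nat * int * I)%type -> Prop)
    (h h' : rcmx R I I) :
  small_normal (fun=> True) N -> rcinv h h' -> N (blk_single (0%N, 0 : int) h).
Proof.
move=> nN [hh' h'h].
(* In a place [(n, z)], [n] numbers the elements fed to the pigeonhole, and [z] is the direction of
   the shift. *)
pose B (g : rcmx R I I) n (t : nat * int) := if (t.1 == n) && (0 < t.2) then g else rone.
have BI n t : rcinv (B h n t) (B h' n t).
  by rewrite /B; case: ifP => _; split; rewrite ?rmul1l.
have [a [b [ab Nab]]] := sn_pigeon nN (fun n => blk_inv (BI n)) (fun=> Logic.I).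
rewrite blkM in Nab; set k := (fun t => _) in Nab.
pose k' t := B h' b t ** B h a t.
have kI t : rcinv (k t) (k' t).
  have [e1 e2] := BI a t; have [e3 e4] := BI b t; split.
    by rewrite /k /k' rmulA -(rmulA (B h' a t)) e3 rmul1r.
  by rewrite /k /k' rmulA -(rmulA (B h' b t)) e1 rmul1r.
pose s d (t : nat * int) := if t.1 == b then (b, t.2 + d) else t.
have sK d : cancel (s d) (s (- d)).
  by case=> n z; rewrite /s /=; case: (eqVneq n b) => [->|/negbTE nb] /=; rewrite ?eqxx ?addrK ?nb.
have s'K : cancel (s (-1)) (s 1) by have := sK (-1); rewrite opprK.
have [Pi PB] := blk_perm (sK 1) s'K k.
(* The inverse of [k] and the shifted [k] cancel at every place but [(b, 0)], where the shifted [k]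
   is already [h] and the inverse is still trivial. *)
have Nb : N (blk_single (b, 0 : int) h).
  have := sn_mul nN (sn_inv nN Nab (blk_inv kI)) (sn_conj nN Nab Pi Logic.I).
  rewrite PB blkM; congr N; apply: eq_blk => -[n z].
  rewrite /= /k' /k /B /s /= xpair_eqE.
  case: (eqVneq n b) => [->|nb] /=.
    rewrite eq_sym (negbTE ab) !eqxx /= !rmul1l !rmul1r.
    case: (ltrgtP z 0) => [z0|z0|->] //=.
    - by rewrite rmul1l ltNge lezD1 z0.
    - by rewrite ltr_wpDr ?h'h.
    - by rewrite rmul1l.
  rewrite (negbTE nb) /= !rmul1l rmul1r.
  by case: ifP => _; rewrite ?rmul1l.
(* The pigeonhole gives no control over [b]; a transposition of places moves the block to
   [(0, 0)]. *)
pose w (t : nat * int) := if t == (0%N, 0 : int) then (b, 0)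
  else if t == (b, 0 : int) then (0%N, 0) else t.
have wK : cancel w w.
  move=> t; rewrite /w; case: (eqVneq t (0%N, 0)) => [->|t0].
    by rewrite eqxx; case: eqP.
  case: (eqVneq t (b, 0)) => [->|tb]; first by rewrite eqxx.
  by rewrite (negbTE t0) (negbTE tb).
have [Wi WB] := blk_perm wK wK (fun t => if t == (b, 0 : int) then h else rone).
have := sn_conj nN Nb Wi Logic.I; rewrite WB; congr N; apply: eq_blk => t /=.
by rewrite (can2_eq wK wK) /w eqxx; case: (eqVneq (b, 0 : int) (0%N, 0)) => // ->.
Qed.

Section Embedding.
Variables (R : comNzRingType) (I J : choiceType) (E : rcmx R I J).
Hypothesis EE : E ** rtr E = rone.

(* [h] acting on the image of the coisometry [E], completed by the identity. *)
Definition emb (h : rcmx R I I) : rcmx R J J := rone + rtr E ** (h - rone) ** E.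

Lemma emb1 : emb rone = rone.
Proof. by rewrite /emb subrr rmul0 rmul0l addr0. Qed.

Lemma embM h k : emb (h ** k) = emb h ** emb k.
Proof.
have D (A B C : rcmx R I I) : rtr E ** (A + (B + C)) ** E =
    rtr E ** A ** E + (rtr E ** B ** E + rtr E ** C ** E).
  by rewrite !rmulDr !rmulDl.
have hk : h ** k - rone = (k - rone) + ((h - rone) + (h - rone) ** (k - rone)).
  rewrite rmulBl !rmulBr !rmul1l !rmul1r.
  by rewrite addrCA subrKC [RHS]addrC subrKA.
rewrite /emb hk D [RHS]rmulDl rmul1l (rmulDr (_ ** E)) rmul1r addrA.
by rewrite !rmulA -(rmulA _ E (rtr E)) EE rmul1r.
Qed.

Lemma emb_inv h h' : rcinv h h' -> rcinv (emb h) (emb h').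
Proof. by case=> a b; split; rewrite -embM ?a ?b emb1. Qed.

(** [emb] is a homomorphism into the matrices satisfying [S], so pulling [N] back removes the
    condition [S]. *)
Lemma emb_small (S N : rcmx R J J -> Prop) : small_normal S N ->
  (forall h, S (emb h)) -> small_normal (fun=> True) (fun h => N (emb h)).
Proof.
move=> nN Se; split.
- by move=> A B NA NB; rewrite embM; apply: (sn_mul nN).
- by move=> A A' NA /emb_inv; apply: (sn_inv nN).
- by move=> A B B' NA /emb_inv iB _; rewrite !embM; apply: (sn_conj nN).
- move=> x x' xx' _.
  have [a [b [ab Nab]]] := sn_pigeon nN (fun n => emb_inv (xx' n)) (fun n => Se (x n)).
  by exists a, b; rewrite embM.
Qed.

End Embedding.

Lemma injmx_comp (R : comNzRingType) (I J K : choiceType) (f : I -> J) (g : J -> K)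
    (fI : injective f) (gI : injective g) (fgI : injective (g \o f)) :
  injmx R fI ** injmx R gI = injmx R fgI.
Proof. by apply: rcmxP => i k; rewrite injmx_mul. Qed.

(** The image of [F] holds the infinitely many copies of [I] needed by the swindle; [h] acts on the
    copy at [(0, 0)]. *)
Lemma emb_in_small (R : comNzRingType) (I J : choiceType)
    (F : nat * int * I -> J) (FI : injective F)
    (fI : injective (fun x => F ((0%N, 0 : int), x)))
    (S N : rcmx R J J -> Prop) (h h' : rcmx R I I) :
  small_normal S N -> (forall k, S (emb (injmx R FI) k)) -> rcinv h h' ->
  N (emb (injmx R fI) h).
Proof.
move=> nN Se hh'.
have := swindle (emb_small (injmxK R FI) nN Se) hh'; congr N.
rewrite blk_singleE /emb [_ + _ - _]addrC addKr -(injmx_comp R (@pair_inj _ _ (0%N, 0)) FI).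
by rewrite rtr_mul !rmulA.
Qed.

(** * Unipotent matrices and matrices with room *)

Definition ann (R : comNzRingType) (L : set (infseq R)) (K : choiceType)
    (X : rcmx R nat K) :=
  forall l : rcmx R unit nat, L (l tt) -> l ** X = 0.

Section Annihilators.
Variables (R : comNzRingType) (L : set (infseq R)).

Lemma annM (J K : choiceType) (X : rcmx R nat J) (U : rcmx R J K) :
  ann L X -> ann L (X ** U).
Proof. by move=> LX l Ll; rewrite rmulA LX // rmul0l. Qed.

Lemma annD (J : choiceType) (X Y : rcmx R nat J) :
  ann L X -> ann L Y -> ann L (X + Y).
Proof. by move=> LX LY l Ll; rewrite rmulDr LX ?LY ?addr0. Qed.

Lemma annN (J : choiceType) (X : rcmx R nat J) : ann L X -> ann L (- X).
Proof. by move=> LX l Ll; rewrite rmulNr LX ?oppr0. Qed.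

Lemma ann_injmx m (J : choiceType) (f : J -> nat) (fI : injective f) :
  (forall l k, L l -> (m <= k)%N -> l k = 0) -> (forall x, (m <= f x)%N) ->
  ann L (rtr (injmx R fI)).
Proof.
by move=> Lm fm l Ll; apply: rcmxP => -[] x; rewrite mul_injmxT (Lm (l tt)).
Qed.

End Annihilators.

Lemma rcinv_nil (R : comNzRingType) (I : choiceType) (Z : rcmx R I I) :
  Z ** Z = 0 -> rcinv (rone + Z) (rone - Z).
Proof.
move=> ZZ; split.
  by rewrite rmulDl rmul1l rmulBr rmul1r ZZ subr0 subrK.
by rewrite rmulBl rmul1l rmulDr rmul1r ZZ addr0 addrK.
Qed.

Definition rscal (R : comNzRingType) (I : choiceType) (u : R) : rcmx R I I.
Proof.
apply: (@Rcmx R I I (fun i j => u * (i == j)%:R)) => i; exists [:: i] => j.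
  by rewrite inE eq_sym => /negbTE ->; rewrite mulr0.
by rewrite inE => /negbTE ->; rewrite mulr0.
Defined.

Lemma rcinv_two (R : comNzRingType) (I : choiceType) (u : R) : u + u = 1 ->
  rcinv (rone + rone : rcmx R I I) (rscal I u).
Proof.
move=> u2; suff E : rscal I u + rscal I u = rone.
  by split; rewrite ?rmulDl ?rmulDr ?rmul1l ?rmul1r.
by apply: rcmxP => i j; rewrite rcD /= -mulrDl u2 mul1r.
Qed.

Section MinimalityMatrix.
Variables (R : comNzRingType) (L M : set (infseq R)) (m : nat) (half : R).
Hypotheses (halfE : half + half = 1)
  (Lm : forall l k, L l -> (m <= k)%N -> l k = 0)
  (Mm : forall l k, M l -> (m <= k)%N -> l k = 0).

(** The form [1 + X Y], free of the choice of [b] and [c]; invertibility is imposed separately by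
    [rcinv]. Countability of [K] allows copies of it inside the indices beyond [m]. *)
Definition bul (A : rcmx R nat nat) :=
  exists (K : countType) (X : rcmx R nat K) (Y : rcmx R K nat),
    [/\ ann L X, ann M (rtr Y) & A = rone + X ** Y].

Variable N : rcmx R nat nat -> Prop.
Hypothesis nN : small_normal bul N.

Lemma bul_emb (K : countType) (f : K -> nat) (fI : injective f) h :
  (forall x, (m <= f x)%N) -> bul (emb (injmx R fI) h).
Proof.
move=> fm; exists K, (rtr (injmx R fI)), ((h - rone) ** injmx R fI); split.
- exact: ann_injmx Lm fm.
- by rewrite rtr_mul; apply: annM; apply: ann_injmx Mm fm.
- by rewrite rmulA.
Qed.

Section Room.
Variables (K : countType) (s : nat -> nat).
Hypotheses (sI : injective s) (sm : forall n, (m <= s n)%N).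

Definition place (x : nat * int * K) : nat := s (pickle x).

Lemma place_inj : injective place.
Proof. by move=> x y /sI /(pcan_inj pickleK). Qed.

Definition place0 (x : K) : nat := place ((0%N, 0 : int), x).

Lemma place0_inj : injective place0.
Proof. by move=> x y /place_inj []. Qed.

Let e := injmx R place0_inj.

Let ee : e ** rtr e = rone. Proof. exact: injmxK. Qed.

Let ann_e (P : set (infseq R)) :
  (forall l k, P l -> (m <= k)%N -> l k = 0) -> ann P (rtr e).
Proof. by move=> Pm; apply: ann_injmx Pm _ => x; apply: sm. Qed.

Lemma emb_place0 h h' : rcinv h h' -> N (emb e h).
Proof.
move=> hh'; apply: (emb_in_small (FI := place_inj) place0_inj nN) hh' => k.
by apply: bul_emb => x; apply: sm.
Qed.

(* With [d] equal to 2 on the image of [e], conjugation by [d] doubles [Z],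
   hence [1 + Z] is a commutator with [d]. *)
Lemma unip_in (Z d d' : rcmx R nat nat) : Z ** Z = 0 -> bul (rone - Z) ->
  N d -> rcinv d d' -> d' ** (rone + Z) ** d = rone + Z + Z -> N (rone + Z).
Proof.
move=> ZZ bZ Nd dd' dZ; have Nd' := sn_inv nN Nd dd'.
have := sn_mul nN (sn_conj nN Nd' (rcinv_sym (rcinv_nil ZZ)) bZ) Nd.
congr N; rewrite -!rmulA [(d' ** _)]rmulA dZ rmulBl rmul1l !rmulDr rmul1r ZZ !addr0.
by rewrite addrK.
Qed.

Let d := emb e (rone + rone).
Let d' := emb e (rscal K half).
Let Nd : N d. Proof. exact: emb_place0 (rcinv_two _ halfE). Qed.
Let dd' : rcinv d d'. Proof. by have /(emb_inv ee) := rcinv_two K halfE. Qed.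

Let emb_l (J : choiceType) h (X : rcmx R nat J) : e ** X = 0 -> emb e h ** X = X.
Proof. by move=> eX; rewrite /emb rmulDl rmul1l -!rmulA eX !rmul0 addr0. Qed.

Let emb_r (J : choiceType) h (Y : rcmx R J nat) : Y ** rtr e = 0 -> Y ** emb e h = Y.
Proof. by move=> Ye; rewrite /emb (rmulDr Y) rmul1r !rmulA Ye !rmul0l addr0. Qed.

Let e_emb h : e ** emb e h = h ** e.
Proof. by rewrite /emb (rmulDr e) rmul1r !rmulA ee rmul1l rmulBl rmul1l subrKC. Qed.

Let emb_e h : emb e h ** rtr e = rtr e ** h.
Proof. by rewrite /emb rmulDl rmul1l -!rmulA ee rmul1r rmulBr rmul1r subrKC. Qed.

(** Since [e ** X = 0], [d'] fixes [X], while [e ** d] is [2 e]; hence conjugation doubles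
    [X ** e]. *)
Lemma unip_right (X : rcmx R nat K) : ann L X -> e ** X = 0 -> N (rone + X ** e).
Proof.
move=> LX eX; have [_ d'd] := dd'; apply: (@unip_in _ d d') => //.
- by rewrite rmulA -(rmulA X e) eX rmul0 rmul0l.
- exists K, (- X), e; split; first exact: annN; first exact: ann_e.
  by rewrite rmulNl.
- rewrite (rmulDr d') rmul1r (rmulDl _ _ d) d'd [d' ** _]rmulA emb_l // -(rmulA X e) e_emb.
  by rewrite rmulDl rmul1l rmulDr addrA.
Qed.

(** Here [d] doubles [rtr e] and [d'] fixes [Y], so [d] and [d'] exchange roles. *)
Lemma unip_left (Y : rcmx R K nat) : ann M (rtr Y) -> Y ** rtr e = 0 ->
  N (rone + rtr e ** Y).
Proof.
move=> MY Ye; have [dd1 _] := dd'.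
apply: (@unip_in _ d' d) => //.
- by rewrite rmulA -(rmulA (rtr e) Y) Ye rmul0 rmul0l.
- exists K, (rtr e), (- Y); split; first exact: ann_e.
    by rewrite rtrN; apply: annN.
  by rewrite rmulNr.
- exact (sn_inv nN Nd dd').
- exact: rcinv_sym.
- rewrite (rmulDr d) rmul1r (rmulDl _ _ d') dd1 -!rmulA emb_r // rmulA emb_e.
  by rewrite rmulDr rmul1r rmulDl addrA.
Qed.

(* Whitehead's lemma for [A = 1 + X Y] and [h = 1 + Y X]: the matrix
   [A (+) h^-1] is a product of four unipotents. *)
Lemma whitehead (A A' : rcmx R nat nat) (X : rcmx R nat K) (Y : rcmx R K nat) :
  ann L X -> ann M (rtr Y) -> e ** X = 0 -> Y ** rtr e = 0 ->
  A = rone + X ** Y -> rcinv A A' -> N A.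
Proof.
move=> LX MY eX Ye AE [AA' A'A].
(* [h'] is the push-through formula for the inverse of [1 + Y X]; the relations [A X = X h] and
   [Y A = h Y] drive the computation. *)
pose h := rone + Y ** X; pose h' := rone - Y ** A' ** X.
have AX : A ** X = X ** h by rewrite AE rmulDl rmul1l /h rmulDr rmul1r rmulA.
have YA : Y ** A = h ** Y by rewrite AE rmulDr rmul1r /h rmulDl rmul1l rmulA.
have hh' : rcinv h h'.
  split; rewrite /h'.
    rewrite rmulBr rmul1r !rmulA -YA -(rmulA Y A) AA' rmul1r.
    by rewrite /h addrK.
  rewrite rmulBl rmul1l -!rmulA -AX (rmulA A') A'A rmul1l.
  by rewrite /h addrK.
have [hh1 h'h] := hh'.
have Ae : A ** rtr e = rtr e by rewrite AE rmulDl rmul1l -rmulA Ye rmul0 addr0.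
pose p := (rone - rtr e ** (h' ** Y)) ** ((rone + X ** e) ** (rone + rtr e ** Y)
  ** (rone - X ** h' ** e)).
have pE : p = A ** emb e h'.
  have -> : A ** emb e h' = A - rtr e ** (Y ** X ** h') ** e.
    have h'1 : h' - rone = - (Y ** X ** h').
      by move: hh1; rewrite {1}/h rmulDl rmul1l => <-; rewrite opprD addrA subrr sub0r.
    by rewrite /emb (rmulDr A) rmul1r h'1 rmulNr rmulNl rmulNr !rmulA Ae.
  rewrite /p; have -> : (rone + X ** e) ** (rone + rtr e ** Y)
      = A + rtr e ** Y + X ** e.
    rewrite rmulDl rmul1l rmulDr rmul1r rmulA -(rmulA X e) ee rmul1r AE.
    by rewrite [X ** e + _]addrC addrA [rone + _ + X ** Y]addrAC.
  have -> : (A + rtr e ** Y + X ** e) ** (rone - X ** h' ** e)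
      = A + rtr e ** Y - rtr e ** (Y ** X ** h') ** e.
    rewrite rmulBr rmul1r !rmulDl.
    have -> : A ** (X ** h' ** e) = X ** e.
      by rewrite !rmulA AX -(rmulA X h) hh1 rmul1r.
    have -> : X ** e ** (X ** h' ** e) = 0.
      by rewrite !rmulA -(rmulA X e X) eX rmul0 !rmul0l.
    by rewrite addr0 opprD addrA addrK !rmulA.
  rewrite rmulBl rmul1l.
  have -> : rtr e ** (h' ** Y) ** (A + rtr e ** Y - rtr e ** (Y ** X ** h') ** e)
     = rtr e ** Y.
    have Ye' : rtr e ** (h' ** Y) ** rtr e = 0 by rewrite -!rmulA Ye !rmul0.
    rewrite rmulBr rmulDr !rmulA in Ye' *; rewrite Ye' !rmul0l subr0 addr0.
    by rewrite -!rmulA YA (rmulA h') h'h rmul1l.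
  by rewrite addrAC addrK.
have Np : N p.
  apply: (sn_mul nN); last apply: (sn_mul nN); last first.
  - rewrite -rmulNl; apply: unip_right.
      by apply: annN; apply: annM.
    by rewrite rmulNr rmulA eX rmul0l oppr0.
  - apply: (sn_mul nN); first exact: unip_right.
    exact: unip_left.
  - rewrite -rmulNr; apply: unip_left.
      by rewrite rtrN rtr_mul; apply: annN; apply: annM.
    by rewrite rmulNl -rmulA Ye rmul0 oppr0.
(* The factor [emb e h] that undoes [h'] lies in [N] by the swindle. *)
have := sn_mul nN Np (emb_place0 hh'); rewrite pE -rmulA -embM // h'h.
by rewrite emb1 rmul1r.
Qed.

End Room.

(** The indices [s n], on which [A] is the identity, leave room for a copy of the inner index set
    [K]. *)
Lemma room_in (A A' : rcmx R nat nat) (s : nat -> nat) :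
  injective s -> (forall n, (m <= s n)%N) -> bul A -> rcinv A A' ->
  (forall n j, A (s n) j = (s n == j)%:R) ->
  (forall n i, A i (s n) = (i == s n)%:R) -> N A.
Proof.
move=> sI sm [K [X [Y [LX MY AE]]]] iA As sA.
pose e := injmx R (place0_inj (K := K) sI).
have ee : e ** rtr e = rone by exact: injmxK.
have eXY : e ** (X ** Y) = 0.
  apply: (addrI (e ** rone)); rewrite -rmulDr -AE rmul1r addr0.
  by apply: rcmxP => x j; rewrite injmx_mul /= As.
have XYe : X ** Y ** rtr e = 0.
  apply: (addrI (rone ** rtr e)); rewrite -rmulDl -AE rmul1l addr0.
  by apply: rcmxP => x j; rewrite mul_injmxT /= sA eq_sym.
have annE (P : set (infseq R)) :
    (forall l k, P l -> (m <= k)%N -> l k = 0) -> ann P (rtr e).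
  by move=> Pm; apply: ann_injmx Pm _ => x; apply: sm.
(* Removing the components along [e] preserves [X ** Y], because [e] annihilates it on both
   sides. *)
pose X1 := X - rtr e ** (e ** X); pose Y1 := Y - Y ** rtr e ** e.
apply: (@whitehead K s sI sm A A' X1 Y1) => //.
- by apply: annD => //; apply: annN; apply: annM; apply: annE.
- rewrite /Y1 rtrD rtrN rtr_mul; apply: annD => //; apply: annN; apply: annM.
  exact: annE.
- by rewrite rmulBr rmulA ee rmul1l subrr.
- by rewrite rmulBl -!rmulA ee rmul1r subrr.
- rewrite AE /X1 /Y1; congr (_ + _); rewrite rmulBl.
  have -> : rtr e ** (e ** X) ** (Y - Y ** rtr e ** e) = 0.
    have Z : rtr e ** e ** X ** Y = 0 by rewrite -!rmulA eXY rmul0.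
    by rewrite rmulBr !rmulA Z !rmul0l subrr.
  by rewrite subr0 rmulBr !rmulA XYe rmul0l subr0.
Qed.

End MinimalityMatrix.

Lemma rcinv_mul (R : comNzRingType) (I : choiceType) (A A' B B' : rcmx R I I) :
  rcinv A A' -> rcinv B B' -> rcinv (A ** B) (B' ** A').
Proof.
move=> [a1 a2] [b1 b2]; split.
  by rewrite rmulA -(rmulA A) b1 rmul1r.
by rewrite rmulA -(rmulA B') a2 rmul1r.
Qed.

(** * Products and inverses of the matrices [1 + X Y] *)

Section Generators.
Variables (R : comNzRingType) (L M : set (infseq R)).
Variables (J : countType) (X0 : rcmx R nat J) (Y0 : rcmx R J nat).
Hypotheses (LX0 : ann L X0) (MY0 : ann M (rtr Y0)).
Hypothesis genX : forall (K : choiceType) (X : rcmx R nat K),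
  ann L X -> exists U, X = X0 ** U.
Hypothesis genY : forall (K : choiceType) (Y : rcmx R K nat),
  ann M (rtr Y) -> exists U, Y = U ** Y0.

(** Fixed generators [X0] and [Y0] of the two annihilators give all elements the same inner index
    set, which makes products and inverses computable. *)
Lemma bulP A : bul L M A <-> exists U, A = rone + X0 ** U ** Y0.
Proof.
split=> [[K [X [Y [LX MY ->]]]]|[U ->]].
  have [U ->] := genX LX; have [V ->] := genY MY.
  by exists (U ** V); rewrite !rmulA.
exists J, (X0 ** U), Y0; split=> //; exact: annM.
Qed.

Lemma bul1 : bul L M rone.
Proof. by apply/bulP; exists 0; rewrite rmul0 rmul0l addr0. Qed.

Lemma bulM A B : bul L M A -> bul L M B -> bul L M (A ** B).
Proof.
move=> /bulP[U ->] /bulP[V ->]; apply/bulP; exists (U + V + U ** Y0 ** X0 ** V).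
have -> : X0 ** (U + V + U ** Y0 ** X0 ** V) ** Y0 =
    X0 ** U ** Y0 + X0 ** V ** Y0 + X0 ** U ** Y0 ** (X0 ** V ** Y0).
  by rewrite !rmulDr !rmulDl !rmulA.
set S := _ ** U ** _; set T := _ ** V ** _.
by rewrite rmulDl rmul1l (rmulDr S) rmul1r -!addrA; congr (_ + _); rewrite addrCA.
Qed.

Lemma bulV A A' : bul L M A -> rcinv A A' -> bul L M A'.
Proof.
move=> /bulP[U AE] [AA' A'A]; apply/bulP.
(* For [S = A - 1], the identity [A' = 1 - S + S A' S] encloses the correction to 1 between [X0] and
   [Y0]. *)
exists (U ** Y0 ** A' ** X0 ** U - U); set S := X0 ** U ** Y0 in AE *.
have -> : X0 ** (U ** Y0 ** A' ** X0 ** U - U) ** Y0 = S ** A' ** S - S.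
  by rewrite rmulBr rmulBl !rmulA.
have SA' : S ** A' = rone - A' by rewrite -AA' AE rmulDl rmul1l addrC addKr.
have A'S : A' ** S = rone - A' by rewrite -A'A AE rmulDr rmul1r addrC addKr.
by rewrite SA' rmulBl rmul1l A'S addrAC subrr sub0r opprB subrKC.
Qed.

End Generators.

(** * Sparse basis vectors and exchange involutions *)

Lemma ann_supp (R : comNzRingType) (L : set (infseq R)) m (K : choiceType)
    (X : rcmx R nat K) : (forall l k, L l -> (m <= k)%N -> l k = 0) ->
  (forall x k, (x < m)%N -> X x k = 0) -> ann L X.
Proof.
move=> Lm Xm l Ll; apply: rcmxP => u k; rewrite rc0 rmulE; apply: fsbig1 => x _.
by case: (ltnP x m) => xm; [rewrite Xm ?mulr0|case: u; rewrite (Lm (l tt)) ?mul0r].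
Qed.

(** With [r c = 2], the square is [1 - 2 c r + c (r c) r = 1]. *)
Lemma reflection_inv (R : comNzRingType) (I K : choiceType)
    (c : rcmx R I K) (r : rcmx R K I) :
  r ** c = rone + rone -> rcinv (rone - c ** r) (rone - c ** r).
Proof.
move=> rc; suff E : (rone - c ** r) ** (rone - c ** r) = rone by [].
rewrite rmulBl rmul1l rmulBr rmul1r !rmulA -(rmulA c) rc rmulDr rmul1r rmulDl.
by rewrite [c ** r - (_ + _)](_ : _ = - (c ** r)) ?opprK ?subrK // opprD addrA subrr sub0r.
Qed.

(** Makes the mixed products in [exchangeP] vanish and keeps the exchanged rows and columns off the
    first [m] coordinates. *)
Definition sparse (R : comNzRingType) m (s : nat -> nat) (A : rcmx R nat nat) :=
  (forall n n', n != n' -> A (s n) (s n') = 0) /\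
  (forall x n, (x < m)%N -> A x (s n) = 0 /\ A (s n) x = 0).

(** Greedy choice: each index lies beyond the supports of all rows and columns of [A] and [A'] up to
    the index chosen before it. *)
Lemma sparse_seq (R : comNzRingType) m (A A' : rcmx R nat nat) :
  exists s : nat -> nat, [/\ injective s, forall n, (m <= s n)%N,
    sparse m s A & sparse m s A'].
Proof.
have bnd (v : infseq R) : fsupp v -> exists n, forall k, (n <= k)%N -> v k = 0.
  by move=> /fsuppP/finsupp_bound.
have bA (B : rcmx R nat nat) i : exists n, forall k, (n <= k)%N -> B i k = 0 /\ B k i = 0.
  have [n1 P1] := bnd _ (rc_row B i); have [n2 P2] := bnd _ (rc_col B i).
  by exists (maxn n1 n2) => k; rewrite geq_max => /andP[/P1 -> /P2 ->].
have /choice[b bP] : forall i, exists n, forall k, (n <= k)%N ->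
    (A i k = 0 /\ A k i = 0) /\ (A' i k = 0 /\ A' k i = 0).
  move=> i; have [n1 P1] := bA A i; have [n2 P2] := bA A' i.
  by exists (maxn n1 n2) => k; rewrite geq_max => /andP[/P1 [-> ->] /P2 [-> ->]].
pose M x := (\max_(y < x.+1) b y)%N.
have bM x y : (y <= x)%N -> (b y <= M x)%N.
  by move=> yx; apply: (leq_bigmax (Ordinal (yx : (y < x.+1)%N))).
pose s := fix s n := if n is n'.+1 then maxn (s n').+1 (M (s n')) else maxn m (M m).
have sS n : (s n < s n.+1)%N by rewrite /= leq_max leqnn.
have sM : {homo s : n n' / (n < n')%N} by apply: homo_ltn => //; exact: ltn_trans.
have s0 n : (s 0 <= s n)%N by case: n => // n; apply/ltnW/sM.
have ms n : (m <= s n)%N by apply: leq_trans (s0 n); rewrite /= leq_max leqnn.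
have bs n n' : (n < n')%N -> (b (s n) <= s n')%N.
  case: n' => // n'; rewrite ltnS /= => nn'; rewrite leq_max orbC bM //.
  by move: nn'; rewrite leq_eqVlt => /orP[/eqP->//|/sM/ltnW].
have bx x n : (x < m)%N -> (b x <= s n)%N.
  by move=> /ltnW xm; apply: leq_trans (s0 n); rewrite /= leq_max orbC bM.
exists s; split=> //.
- move=> n n' E; case: (ltngtP n n') => // /sM; rewrite E ltnn //.
- split=> [n n'|x n xm].
    by rewrite neq_ltn => /orP[]/bs/bP[[e1 e2] _].
  by have [[-> ->]] := bP _ _ (bx x n xm).
- split=> [n n'|x n xm].
    by rewrite neq_ltn => /orP[]/bs/bP[_ [e1 e2]].
  by have [_ [-> ->]] := bP _ _ (bx x n xm).
Qed.

Section AllSmall.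
Variables (R : comNzRingType) (L M : set (infseq R)) (m : nat) (half : R).
Hypotheses (halfE : half + half = 1)
  (Lm : forall l k, L l -> (m <= k)%N -> l k = 0)
  (Mm : forall l k, M l -> (m <= k)%N -> l k = 0).
Variable N : rcmx R nat nat -> Prop.
Hypothesis nN : small_normal (bul L M) N.
Variable s : nat -> nat.
Hypotheses (sI : injective s) (sm : forall n, (m <= s n)%N).

(** Three disjoint subsequences: [exchange] swaps data attached to the first two, and the third
    remains as room for [room_in]. *)
Definition third (d n : nat) := s (3 * n + d).

Lemma third_inj d : injective (third d).
Proof. by move=> n n' /sI; lia. Qed.

Let Ei := injmx R (@third_inj 0).
Let Ej := injmx R (@third_inj 1).
Let El := injmx R (@third_inj 2).

(* An involution exchanging the basis vectors [Ej] with the rows [Ei ** A]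
   and the columns [A' ** rtr Ei]. *)
Definition exchange (A A' : rcmx R nat nat) :=
  rone - (A' ** rtr Ei - rtr Ej) ** (Ei ** A - Ej).

(** By sparsity the row factor times the column factor is 2, so [k] is a reflection; it fixes the
    basis vectors of [El], which gives [room_in] its room. *)
Lemma exchangeP A A' : rcinv A A' -> sparse m s A -> sparse m s A' ->
  let k := exchange A A' in
  [/\ rcinv k k, bul L M k, N k, Ei ** A ** k = Ej & k ** rtr Ej = A' ** rtr Ei].
Proof.
move=> [AA' A'A] [As Am] [A's A'm] k.
have aa : Ei ** A ** (A' ** rtr Ei) = rone.
  by rewrite rmulA -(rmulA Ei) AA' rmul1r injmxK.
have ae : Ei ** A ** rtr Ej = 0.
  by apply: rcmxP => n n'; rewrite mul_injmxT injmx_mul /third As //; lia.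
have ea : Ej ** (A' ** rtr Ei) = 0.
  by apply: rcmxP => n n'; rewrite injmx_mul mul_injmxT /third A's //; lia.
have ee : Ej ** rtr Ej = rone by exact: injmxK.
have kk : rcinv k k.
  apply: reflection_inv; rewrite rmulBl !rmulBr aa ae ea ee.
  by rewrite subr0 sub0r opprK.
have bk : bul L M k.
  exists nat, (- (A' ** rtr Ei - rtr Ej)), (Ei ** A - Ej); split.
  - apply: annN; apply: (ann_supp Lm) => x n xm.
    rewrite rcB mul_injmxT (A'm _ _ xm).1 /= sub0r.
    by rewrite gtn_eqF ?oppr0 // (leq_trans xm (sm _)).
  - apply: (ann_supp Mm) => x n xm /=.
    rewrite -[rmulf _ _ _ _]/((Ei ** A) n x) injmx_mul (Am _ _ xm).2 sub0r.
    by rewrite gtn_eqF ?oppr0 // (leq_trans xm (sm _)).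
  - by rewrite rmulNl.
have kl : k ** rtr El = rtr El.
  rewrite /k /exchange rmulBl rmul1l -rmulA.
  suff -> : (Ei ** A - Ej) ** rtr El = 0 by rewrite rmul0 subr0.
  apply: rcmxP => n n'; rewrite mul_injmxT rcB injmx_mul /= /third As ?sub0r; last lia.
  by rewrite (inj_eq sI) (_ : _ == _ = false) ?oppr0 //; lia.
have lk : El ** k = El.
  rewrite /k /exchange rmulBr rmul1r rmulA.
  suff -> : El ** (A' ** rtr Ei - rtr Ej) = 0 by rewrite rmul0l subr0.
  apply: rcmxP => n n'; rewrite injmx_mul rcB mul_injmxT /= /third A's ?sub0r; last lia.
  by rewrite (inj_eq sI) (_ : _ == _ = false) ?oppr0 //; lia.
split=> //.
- apply: (room_in halfE Lm Mm nN (@third_inj 2) _ bk kk) => [n|n j|n i].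
  + exact: sm.
  + by rewrite -(injmx_mul (@third_inj 2)) lk.
  + by rewrite -(mul_injmxT (@third_inj 2)) kl /= eq_sym.
- rewrite /k /exchange rmulBr rmul1r rmulA (rmulBr (Ei ** A) (A' ** _)) aa ae subr0 rmul1l.
  by rewrite opprB subrKC.
- rewrite /k /exchange rmulBl rmul1l -rmulA (rmulBl _ _ (rtr Ej)) ae ee sub0r rmulNr rmul1r.
  by rewrite opprK subrKC.
Qed.

Hypothesis bulM : forall A B, bul L M A -> bul L M B -> bul L M (A ** B).

(** Multiplied by [t] on the left and [k] on the right, [A] becomes the identity on the basis
    vectors of [Ej], so [room_in] applies; [t] and [k] are involutions in [N]. *)
Lemma all_in (A A' : rcmx R nat nat) : bul L M A -> rcinv A A' ->
  sparse m s A -> sparse m s A' -> N A.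
Proof.
move=> bA iA sA sA'; have [kk bk Nk Ak kA] := exchangeP iA sA sA'.
have [AA' A'A] := iA; have i1 : rcinv (rone : rcmx R nat nat) rone.
  by split; rewrite rmul1l.
have s1 : sparse m s (rone : rcmx R nat nat).
  split=> [n n' nn'|x n xm]; rewrite !roneE.
    by rewrite (inj_eq sI) (negbTE nn').
  by rewrite ltn_eqF ?gtn_eqF // (leq_trans xm (sm _)).
(* For the identity matrix the exchange is the transposition of the basis vectors of [Ei] and
   [Ej]. *)
have [tt bt Nt Et tE] := exchangeP i1 s1 s1.
set k := exchange A A' in kk bk Nk Ak kA; set t := exchange _ _ in tt bt Nt Et tE.
rewrite rmul1r in Et; rewrite rmul1l in tE.
have [tt1 _] := tt; have [kk1 _] := kk.
have jt : Ej ** t = Ei by rewrite -Et -rmulA tt1 rmul1r.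
have tj : t ** rtr Ei = rtr Ej by rewrite -tE rmulA tt1 rmul1l.
have jg : Ej ** (t ** A ** k) = Ej by rewrite !rmulA jt.
have gj : t ** A ** k ** rtr Ej = rtr Ej.
  by rewrite -rmulA kA -rmulA (rmulA A) AA' rmul1l.
have bg : bul L M (t ** A ** k) by apply: bulM => //; apply: bulM.
have Ng : N (t ** A ** k).
  apply: (room_in halfE Lm Mm nN (@third_inj 1) _ bg
    (rcinv_mul (rcinv_mul tt iA) kk)) => [n|n j|n i].
  - exact: sm.
  - by rewrite -(injmx_mul (@third_inj 1)) jg.
  - by rewrite -(mul_injmxT (@third_inj 1)) gj /= eq_sym.
have -> : A = t ** (t ** A ** k) ** k.
  by rewrite !rmulA tt1 rmul1l -rmulA kk1 rmul1r.
by apply: (sn_mul nN) => //; apply: (sn_mul nN).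
Qed.

End AllSmall.

(** * Double annihilators over Z/n *)

(** With [g = gcd(n, d)], [n / g] kills [d] and hence [y], so [g] divides [y]; by Bezout [g] is a
    multiple of [d] modulo [n]. *)
Lemma Zp_double_ann n (d y : 'Z_n) : (1 < n)%N ->
  (forall w : 'Z_n, w * d = 0 -> w * y = 0) -> exists z, y = d * z.
Proof.
move=> n1 dy; have n0 : (0 < n)%N by apply: ltnW.
have nat0 k : ((k%:R : 'Z_n) = 0) <-> (n %| k)%N.
  rewrite /dvdn; split=> [/(congr1 val)|/eqP k0].
    by rewrite /= val_Zp_nat // => ->.
  by apply: val_inj; rewrite /= val_Zp_nat.
have [a _ /nat0] := Bezoutl d n0.
have gn := dvdn_gcdl n d; have gd := dvdn_gcdr n d.
have g0 : (0 < gcdn n d)%N by rewrite gcdn_gt0 n0.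
move: (gcdn n d) gn gd g0 => g gn gd g0.
rewrite natrD natrM natr_Zp => /eqP; rewrite addr_eq0 => /eqP gE.
have /dvdnP[q yq] : (g %| y)%N.
  have ng : (0 < n %/ g)%N by rewrite divn_gt0 //; exact: dvdn_leq.
  rewrite -(dvdn_pmul2l ng) divnK //; apply/nat0; rewrite natrM natr_Zp.
  apply: dy; rewrite -[d]natr_Zp -natrM; apply/nat0.
  by rewrite -{1}(divnK gn) dvdn_pmul2l.
exists (- (a%:R * q%:R)); rewrite -[LHS]natr_Zp yq natrM gE.
by rewrite mulrN mulrN [a%:R * d]mulrC mulrCA [q%:R * _]mulrC.
Qed.

(** Smith normal form over the integers of a lift of [b], reduced back to ['Z_n]. *)
Lemma Zp_Smith n m k (b : 'M['Z_n]_(m, k)) :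
  exists (P : 'M['Z_n]_m) (Q : 'M['Z_n]_k) (d : nat -> 'Z_n),
  [/\ P \in unitmx, Q \in unitmx &
    b = P *m (\matrix_(i, j) (d i *+ (i == j :> nat))) *m Q].
Proof.
pose bi := map_mx (fun x : 'Z_n => (x : nat)%:Z) b.
have [P Pu [Q Qu [d _ biE]]] := int_Smith_normal_form bi.
exists (map_mx intr P), (map_mx intr Q), (fun i => (d`_i)%:~R).
have unitP l (A : 'M[int]_l) : A \in unitmx -> map_mx (intr : int -> 'Z_n) A \in unitmx.
  by rewrite !unitmxE det_map_mx => /(rmorph_unit (intr : {rmorphism int -> 'Z_n})).
split; [exact: unitP|exact: unitP|].
have -> : b = map_mx intr bi by apply/matrixP => i j; rewrite !mxE -pmulrn natr_Zp.
rewrite biE !map_mxM; congr (_ *m _ *m _); apply/matrixP => i j; rewrite !mxE.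
by rewrite rmorphMn.
Qed.

(** The Smith form reduces the claim to diagonal matrices, where the scalar case applies to each
    coordinate. *)
Lemma Zp_mx_double_ann n m k (b : 'M['Z_n]_(m, k)) (x : 'cV_m) : (1 < n)%N ->
  (forall v : 'rV_m, v *m b = 0 -> v *m x = 0) -> exists z, x = b *m z.
Proof.
move=> n1 bx; have [P [Q [d [Pu Qu bE]]]] := Zp_Smith b.
set D := (\matrix_(i, j) _) in bE; pose y := invmx P *m x.
(* A row of index at least [k] has no diagonal entry; the value 0 there forces [y i 0 = 0]. *)
have yd (i : 'I_m) : exists z, y i 0 = (if (i < k)%N then d i else 0) * z.
  apply: Zp_double_ann => // w wd.
  have : (w *: (delta_mx 0 i : 'rV_m) *m invmx P) *m x = 0.
    apply: bx; rewrite bE -!mulmxA mulKmx // mulmxA.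
    rewrite (_ : _ *m D = 0) ?mul0mx //; apply/rowP => j.
    rewrite -scalemxAl -rowE !mxE; case: (eqVneq (i : nat) j) => [E|_].
      by move: wd; rewrite E ltn_ord mulr1n.
    by rewrite mulr0n mulr0.
  by rewrite -mulmxA -/y -scalemxAl -rowE => /rowP/(_ 0); rewrite !mxE.
have [z zP] : exists z : 'I_m -> 'Z_n,
    forall i, y i 0 = (if (i < k)%N then d i else 0) * z i.
  by have /fin_all_exists[z zP] := yd; exists z.
pose u : 'cV_k := \col_j (if insub (j : nat) is Some i then z i else 0).
exists (invmx Q *m u); rewrite bE -!mulmxA mulKVmx //.
rewrite (_ : D *m u = y) ?mulKVmx //; apply/colP => i; rewrite mxE zP.
case: ltnP => ik.
  rewrite (bigD1 (Ordinal ik)) //= !mxE eqxx mulr1n /= insubT //= => im.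
  rewrite big1 ?addr0 => [|j ji]; first by congr (_ * z _); apply: val_inj.
  rewrite !mxE (_ : _ == _ = false) ?mulr0n ?mul0r //.
  by apply: contraNF ji => /eqP ij; apply/eqP/val_inj.
rewrite mul0r big1 // => j _; rewrite !mxE (_ : _ == _ = false) ?mulr0n ?mul0r //.
by rewrite gtn_eqF // (leq_trans (ltn_ord j)).
Qed.

(** * Annihilators of kernels *)

Section Corner.
Variable R : comNzRingType.

Lemma rv_infseq_out m (v : 'rV[R]_m) k : (m <= k)%N -> rv_infseq v k = 0.
Proof. by move=> mk; rewrite /rv_infseq insubF // ltnNge mk. Qed.

Lemma rv_infseq_ord m (v : 'rV[R]_m) (i : 'I_m) : rv_infseq v i = v 0 i.
Proof. by rewrite /rv_infseq insubT //= => im; congr (v 0 _); apply: val_inj. Qed.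

Lemma ker_infseq_bound m N (b : 'M[R]_(m, N)) l k :
  ker_infseq b l -> (m <= k)%N -> l k = 0.
Proof. by move=> [v _ <-]; apply: rv_infseq_out. Qed.

Lemma rowmx_col (v : infseq R) (j : nat) : fsupp (fun _ : unit => v j).
Proof. by exists [:: tt] => -[]. Qed.

Definition rowmx (v : infseq R) (fv : finsupp v) : rcmx R unit nat :=
  Rcmx (fun _ : unit => (fsuppP v).1 fv) (rowmx_col v).

Lemma rv_infseq_fin m (v : 'rV[R]_m) : finsupp (rv_infseq v).
Proof. by apply: (@bound_finsupp _ m) => k; exact: rv_infseq_out. Qed.

(* The matrix / b 0 \
             \ 0 1 /. *)
Definition xcolf m N (b : 'M[R]_(m, N)) (i : nat) (s : 'I_N + nat) : R :=
  match s with
  | inl k => if insub i is Some i' then b i' k else 0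
  | inr j => (i == m + j)%N%:R
  end.

Lemma xcol_row m N (b : 'M[R]_(m, N)) i : fsupp (xcolf b i).
Proof.
exists (inr (i - m)%N :: map inl (enum 'I_N)) => -[k|j].
  by rewrite inE /= map_f ?mem_enum.
rewrite inE negb_or => /andP[ij _]; rewrite /= (_ : _ == _ = false) //.
by apply: contraNF ij => /eqP ->; rewrite addKn.
Qed.

Lemma xcol_col m N (b : 'M[R]_(m, N)) s : fsupp (fun i => xcolf b i s).
Proof.
case: s => [k|j] /=.
  exists (iota 0 m) => i; rewrite mem_iota /= add0n => im.
  by rewrite insubF //; apply/negbTE.
by exists [:: (m + j)%N] => i; rewrite inE => /negbTE ->.
Qed.

Definition xcol m N (b : 'M[R]_(m, N)) := Rcmx (xcol_row b) (xcol_col b).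

Lemma xcol_mulu m N (b : 'M[R]_(m, N)) (K : choiceType) (W : rcmx R _ K) (i : 'I_m) k :
  (xcol b ** W) i k = \sum_a b i a * W (inl a) k.
Proof.
rewrite (@rmul_seq _ _ _ _ _ _ _ _ (map inl (enum 'I_N))).
- rewrite big_map big_enum; apply: eq_bigr => a _ /=.
  by rewrite insubT //= => im; congr (b _ _ * _); apply: val_inj.
- by rewrite map_inj_uniq ?enum_uniq // => x y [].
- case=> [a|j]; first by rewrite map_f ?mem_enum.
  by rewrite /= ltn_eqF // ltn_addr.
Qed.

Lemma xcol_muld m N (b : 'M[R]_(m, N)) (K : choiceType) (W : rcmx R _ K) i k :
  (xcol b ** W) (m + i)%N k = W (inr i) k.
Proof.
rewrite (@rmul_seq _ _ _ _ _ _ _ _ [:: inr i]) //.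
  by rewrite big_seq1 /= eqxx mul1r.
case=> [a|j]; rewrite inE /=.
  by rewrite insubF // ltnNge leq_addr.
rewrite eqn_add2l (_ : (inr j == inr i :> 'I_N + nat) = (j == i)) //.
by rewrite eq_sym => /negbTE ->.
Qed.

Lemma split_at m (P : nat -> Prop) :
  (forall i : 'I_m, P i) -> (forall i, P (m + i)%N) -> forall i, P i.
Proof.
move=> P1 P2 i; case: (ltnP i m) => [im|/subnKC <-]; last exact: P2.
exact: (P1 (Ordinal im)).
Qed.

Definition double_annihilator := forall m k (b : 'M[R]_(m, k)) (x : 'cV_m),
  (forall v : 'rV_m, v *m b = 0 -> v *m x = 0) -> exists z, x = b *m z.

Lemma rowvec_mulE m (l : rcmx R unit nat) (K : choiceType) (X : rcmx R nat K) u k :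
  (forall j, (m <= j)%N -> l tt j = 0) ->
  (l ** X) u k = \sum_(i < m) l tt i * X i k.
Proof.
case: u => lm; rewrite rmulE (@fsum_ord _ m) // => j /lm ->.
by rewrite mul0r.
Qed.

Section Fixed.
Variables (m N : nat) (b : 'M[R]_(m, N)).
Let L := ker_infseq b.

Lemma ann_xcol : ann L (xcol b).
Proof.
move=> l Ll; have [v /= vb lE] := Ll; apply: rcmxP => u k.
rewrite (@rowvec_mulE m) => [|j]; last exact: ker_infseq_bound Ll.
rewrite rc0 -lE.
case: k => [a|j] /=.
  transitivity ((v *m b) 0 a); last by rewrite vb mxE.
  rewrite mxE; apply: eq_bigr => i _; rewrite rv_infseq_ord insubT //= => im.
  by congr (_ * b _ _); apply: val_inj.
by rewrite big1 // => i _; rewrite ltn_eqF ?mulr0 // ltn_addr.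
Qed.

Hypothesis da : double_annihilator.

(** Each column is solved separately: its first [m] entries by the double annihilator property, the
    others by copying into the block 1 of [xcol b]. *)
Lemma ann_factor (K : choiceType) (X : rcmx R nat K) : ann L X ->
  exists U : rcmx R ('I_N + nat)%type K, [/\ X = xcol b ** U,
    forall k, (forall i, (i < m)%N -> X i k = 0) -> forall a, U (inl a) k = 0
    & forall j k, U (inr j) k = X (m + j)%N k].
Proof.
move=> LX.
(* The solution 0 is imposed when the first [m] entries vanish; this makes the rows of [U] finitely
   supported. *)
have /choice[z zP] : forall k, exists z : 'cV[R]_N, (\col_(i < m) X i k = b *m z)
    /\ ((forall i, (i < m)%N -> X i k = 0) -> z = 0).
  move=> k; have [X0|X0] := pselect (forall i, (i < m)%N -> X i k = 0).
    by exists 0; split=> //; rewrite mulmx0; apply/colP => i; rewrite !mxE X0.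
  have [|z zE] := da (b := b) (x := \col_(i < m) X i k); last by exists z.
  move=> v vb; apply/rowP => i0; rewrite (ord1 i0) !mxE.
  have Lv : L (rv_infseq v) by exists v.
  have /(congr1 (fun Y : rcmx R unit K => Y tt k)) := LX (rowmx (rv_infseq_fin v)) Lv.
  rewrite rc0 (@rowvec_mulE m) => [E0|j jm]; last exact: rv_infseq_out.
  rewrite -[RHS]E0.
  by apply: eq_bigr => i _; rewrite mxE /= rv_infseq_ord.
pose Uf (s : 'I_N + nat) k := match s with inl a => z k a 0 | inr j => X (m + j)%N k end.
have Ur s : fsupp (Uf s).
  case: s => [a|j] /=; last exact: rc_row.
  have /choice[t tP] : forall i, exists t : seq K, forall k, k \notin t -> X i k = 0.
    by move=> i; exact: rc_row.
  exists (flatten (map t (iota 0 m))) => k kt; rewrite /Uf (zP k).2 ?mxE // => i im.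
  apply: tP; apply: contra kt => kt; apply/flattenP; exists (t i) => //.
  by rewrite map_f // mem_iota.
have Uc k : fsupp (fun s => Uf s k).
  have [t tP] := rc_col X k.
  exists (map inl (enum 'I_N) ++ map (fun i => inr (i - m)%N) t) => -[a|j].
    by rewrite mem_cat map_f ?mem_enum.
  rewrite mem_cat negb_or => /andP[_ jt] /=; apply: tP; apply: contra jt => jt.
  by apply/mapP; exists (m + j)%N; rewrite ?addKn.
exists (Rcmx Ur Uc); split=> //; last by move=> k /(zP k).2 /= -> a; rewrite mxE.
apply: rcmxP => i k; move: i; apply: (@split_at m) => i; last by rewrite xcol_muld.
rewrite xcol_mulu /=; have /colP/(_ i) := (zP k).1; rewrite !mxE => ->.
by [].
Qed.

End Fixed.

(** After factoring out [xcol b], the zero corner makes the upper rows of [U] vanish on the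
    coordinates below [m], where [M] lives; so [M] still annihilates the rows of [U], and the right
    factor splits off. *)
Lemma corner0_factor m N (b : 'M[R]_(m, N)) (c : 'M[R]_(N, m))
    (D : rcmx R nat nat) : double_annihilator ->
  ann (ker_infseq b) D -> ann (ker_infseq c^T) (rtr D) ->
  (forall i j, (i < m)%N -> (j < m)%N -> D i j = 0) ->
  exists U, D = xcol b ** U ** rtr (xcol c^T).
Proof.
move=> da LD MD D0; have [U [DU U0 U1]] := ann_factor da LD.
have MU : ann (ker_infseq c^T) (rtr U).
  move=> l Ml; apply: rcmxP => u; case=> [a|j]; rewrite rc0 rmulE.
    apply: fsbig1 => k _ /=; case: (ltnP k m) => km.
      by rewrite U0 ?mulr0 // => i im; apply: D0.
    by case: u; rewrite (ker_infseq_bound Ml km) mul0r.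
  rewrite -[RHS]/((0 : rcmx R unit nat) u (m + j)%N) -(MD l Ml) rmulE.
  by apply: eq_fsbigr => k _ /=; rewrite U1.
have [V [VU _ _]] := ann_factor da MU; exists (rtr V).
by rewrite DU -rmulA -rtr_mul -VU rtrK.
Qed.

End Corner.

(** * Matrices of elements of [GLinf] and stability of submodules *)

Section Bridge.
Variable R : comNzRingType.
Implicit Types g h : GLinf R.

Definition mxof g : rcmx R nat nat :=
  Rcmx (fun i => (fsuppP _).1 ((glmx_rcfinite g).1 i))
       (fun j => (fsuppP _).1 ((glmx_rcfinite g).2 j)).

Lemma mxof_mul g h : mxof (g * h)%g = mxof g ** mxof h.
Proof. exact: rcmxP. Qed.

Lemma mxof1 : mxof 1%g = rone.
Proof. exact: rcmxP. Qed.

Lemma mxof_inv g : rcinv (mxof g) (mxof g^-1%g).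
Proof.
split; apply: rcmxP => i j.
  by rewrite -[LHS]/(mulimx g (glinv g) i j) glmxV.
by rewrite -[LHS]/(mulimx (glinv g) g i j) glVmx.
Qed.

Lemma mxof_inj : injective mxof.
Proof.
move=> g h gh; apply: GLinf_inj; apply/funext => i; apply/funext => j.
by rewrite -[LHS]/(mxof g i j) gh.
Qed.

Lemma rc_rcfinite (A : rcmx R nat nat) : rcfinite A.
Proof. by split=> i; apply/fsuppP; [exact: rc_row | exact: rc_col]. Qed.

Lemma mulimx_rone (A B : rcmx R nat nat) : A ** B = rone -> mulimx A B = imx1.
Proof.
move=> AB; apply/funext => i; apply/funext => j.
by rewrite -[LHS]/((A ** B) i j) AB.
Qed.

Lemma mxof_surj (A A' : rcmx R nat nat) : rcinv A A' ->
  exists g, mxof g = A /\ mxof g^-1%g = A'.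
Proof.
move=> [AA' A'A]; exists (MkGLinf (rc_rcfinite A) (rc_rcfinite A')
  (mulimx_rone AA') (mulimx_rone A'A)); split; exact: rcmxP.
Qed.

Lemma mxof_trV g : mxof (GLtr g)^-1%g = rtr (mxof g^-1%g).
Proof. exact: rcmxP. Qed.

Lemma mulivmx_rcmx (l : rcmx R unit nat) g : mulivmx (l tt) g = (l ** mxof g) tt.
Proof. by []. Qed.

Definition stable (L : set (infseq R)) (A : rcmx R nat nat) :=
  forall l : rcmx R unit nat, L (l tt) -> L ((l ** A) tt).

Lemma image_stable (L : set (infseq R)) g : (forall v, L v -> finsupp v) ->
  [set mulivmx v g | v in L] = L <->
  stable L (mxof g) /\ stable L (mxof g^-1%g).
Proof.
move=> Lf; have [gg' g'g] := mxof_inv g; split=> [E|[S1 S2]].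
  have S1 : stable L (mxof g) by move=> l Ll; rewrite -E; exists (l tt).
  split=> // l Ll; move: (Ll); rewrite -{1}E => -[v Lv vl].
  have -> : l = rowmx (Lf _ Lv) ** mxof g.
    by apply: rcmxP => -[] j; rewrite -vl.
  by rewrite -rmulA gg' rmul1r.
apply/seteqP; split=> [_ [v Lv <-]|v Lv].
  exact: (S1 (rowmx (Lf _ Lv))).
exists ((rowmx (Lf _ Lv) ** mxof g^-1%g) tt); first exact: (S2 (rowmx (Lf _ Lv))).
by rewrite mulivmx_rcmx -rmulA g'g rmul1r.
Qed.

Lemma GhatP (L M : set (infseq R)) g :
  (forall v, L v -> finsupp v) -> (forall v, M v -> finsupp v) ->
  Ghat L M g <-> [/\ stable L (mxof g), stable L (mxof g^-1%g),
    stable M (rtr (mxof g)) & stable M (rtr (mxof g^-1%g))].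
Proof.
move=> Lf Mf; have gE : mxof (((GLtr g)^-1)^-1)%g = rtr (mxof g) by exact: rcmxP.
split.
  move=> [/(image_stable _ Lf)[S1 S2] /(image_stable _ Mf)[]].
  by rewrite gE mxof_trV.
move=> [S1 S2 S3 S4]; split; first exact/(image_stable _ Lf).
by apply/(image_stable _ Mf); rewrite gE mxof_trV.
Qed.

End Bridge.

(** * The block form in the definition of G^bullet *)

Section BlockForm.
Variables (R : comNzRingType) (m N : nat) (b : 'M[R]_(m, N)) (c : 'M[R]_(N, m)).
Hypothesis da : double_annihilator R.
Let L := ker_infseq b.
Let M := ker_infseq c^T.
Let X0 := xcol b.
Let Y0 := rtr (xcol c^T).

Lemma mul_Y0l (K : choiceType) (W : rcmx R K _) k (j : 'I_m) :
  (W ** Y0) k j = \sum_a W k (inl a) * c a j.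
Proof.
rewrite -[LHS]/(rtr (W ** Y0) (j : nat) k) rtr_mul rtrK xcol_mulu.
by apply: eq_bigr => a _; rewrite mxE mulrC.
Qed.

Lemma mul_Y0r (K : choiceType) (W : rcmx R K _) k j :
  (W ** Y0) k (m + j)%N = W k (inr j).
Proof. by rewrite -[LHS]/(rtr (W ** Y0) (m + j)%N k) rtr_mul rtrK xcol_muld. Qed.

Lemma block_ul (A : 'M[R]_m) B C D (i j : 'I_m) : block_infmx A B C D i j = A i j.
Proof.
rewrite /block_infmx !insubT //= => im jm.
by congr (A _ _); apply: val_inj.
Qed.

Lemma block_ur (A : 'M[R]_m) B C D (i : 'I_m) j :
  block_infmx A B C D i (m + j)%N = B i j.
Proof.
rewrite /block_infmx insubT //= => im.
rewrite insubF ?ltnNge ?leq_addr // addKn; congr (B _ _); exact: val_inj.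
Qed.

Lemma block_dl (A : 'M[R]_m) B C D i (j : 'I_m) :
  block_infmx A B C D (m + i)%N j = C i j.
Proof.
rewrite /block_infmx insubF ?ltnNge ?leq_addr // insubT //= => jm.
by rewrite addKn; congr (C _ _); exact: val_inj.
Qed.

Lemma block_dr (A : 'M[R]_m) B C D i j :
  block_infmx A B C D (m + i)%N (m + j)%N = D i j.
Proof. by rewrite /block_infmx !insubF ?ltnNge ?leq_addr // !addKn. Qed.

Lemma rone_ord (i j : 'I_m) : (rone : rcmx R nat nat) i j = (1%:M : 'M[R]_m) i j.
Proof. by rewrite roneE mxE. Qed.

Lemma mx_subK (A B : 'M[R]_m) i j : (A - B) i j - A i j = - B i j.
Proof. by rewrite !mxE addrAC subrr sub0r. Qed.

Section FiniteCorner.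
Variable u : 'M[R]_N.

(** [u] extended by zero to the inner index set of [xcol], to correct the corner of a matrix by
    [b u c]. *)
Definition ulf (s t : 'I_N + nat) : R :=
  match s, t with inl k, inl l => u k l | _, _ => 0 end.

Lemma ulf_row s : fsupp (ulf s).
Proof.
exists (map inl (enum 'I_N)) => -[k|j]; first by rewrite map_f ?mem_enum.
by case: s.
Qed.

Lemma ulf_col t : fsupp (fun s => ulf s t).
Proof.
exists (map inl (enum 'I_N)) => -[k|j] //.
by rewrite map_f ?mem_enum.
Qed.

Definition ulmx := Rcmx ulf_row ulf_col.

Lemma ulmx_corner (i j : 'I_m) :
  (X0 ** ulmx ** Y0) i j = (b *m u *m c) i j.
Proof.
rewrite mul_Y0l mxE; apply: eq_bigr => l _; congr (_ * _).
by rewrite xcol_mulu mxE.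
Qed.

End FiniteCorner.

(** Only the first [m] rows matter, [L] being supported there; they form columns [b x], killed
    because [v b = 0]. *)
Lemma ann_columns (K : choiceType) (X : rcmx R nat K) :
  (forall k, exists x : 'I_N -> R, forall i : 'I_m, X i k = \sum_l b i l * x l) ->
  ann L X.
Proof.
move=> XP l Ll; have Ll' := Ll; case: Ll' => v /= vb lE; apply: rcmxP => u0 k.
have [x xP] := XP k.
rewrite (@rowvec_mulE _ m) => [|j]; last exact: ker_infseq_bound Ll.
rewrite rc0 -lE; transitivity ((v *m b *m \col_l x l) 0 0); last by rewrite vb mul0mx mxE.
rewrite -mulmxA mxE; apply: eq_bigr => i _; rewrite rv_infseq_ord xP !mxE.
by congr (_ * _); apply: eq_bigr => a _; rewrite !mxE.
Qed.

End BlockForm.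

Section FormP.
Variables (R : comNzRingType) (m N : nat) (b : 'M[R]_(m, N)) (c : 'M[R]_(N, m)).
Hypothesis da : double_annihilator R.
Let X0 := xcol b.
Let Y0 := rtr (xcol c^T).

Lemma formP (g : GLinf R) :
  Gbullet_form b c g <-> exists U, mxof g = rone + X0 ** U ** Y0.
Proof.
split=> [[u [v [w [z gE]]]]|[U gE]].
  (* Removing the corner term [- b u c] leaves a matrix with zero corner, to which [corner0_factor]
     applies. *)
  pose D := mxof g - rone - X0 ** ulmx (- u) ** Y0.
  have gij i j : mxof g i j = glmx g i j by [].
  have [|||U DU] := @corner0_factor _ m N b c D da.
  - apply: annD; last by apply: annN; do 2 apply: annM; exact: ann_xcol.
    apply: ann_columns; apply: split_at => [j|j].
      exists (fun l => - (u *m c) l j) => i.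
      rewrite rcB gij gE block_ul rone_ord mx_subK.
      rewrite -mulmxA mxE -sumrN.
      by apply: eq_bigr => l _; rewrite mulrN.
    exists (fun l => v l j) => i.
    by rewrite rcB gij gE block_ur roneE ltn_eqF ?subr0 // ltn_addr.
  - rewrite /D rtrD rtrN; apply: annD; last first.
      by apply: annN; rewrite rtr_mul; apply: annM; rewrite rtrK; exact: ann_xcol.
    apply: ann_columns; apply: split_at => [i|i].
      exists (fun l => - (b *m u) i l) => j.
      rewrite -[LHS]/((mxof g - rone) (i : nat) (j : nat)) rcB gij gE block_ul.
      rewrite rone_ord mx_subK mxE -sumrN.
      by apply: eq_bigr => l _; rewrite [c^T _ _]mxE mulrN mulrC.
    exists (fun l => w i l) => j.
    rewrite -[LHS]/((mxof g - rone) (m + i)%N (j : nat)) rcB gij gE block_dl.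
    rewrite roneE gtn_eqF ?ltn_addr // subr0.
    by apply: eq_bigr => l _; rewrite [c^T _ _]mxE mulrC.
  - suff Dij (i j : 'I_m) : D i j = 0.
      by move=> i j im jm; exact: (Dij (Ordinal im) (Ordinal jm)).
    rewrite 2!rcB gij gE block_ul ulmx_corner rone_ord mx_subK.
    by rewrite mulmxN mulNmx [(- (_ *m _)) _ _]mxE opprK addNr.
  exists (U + ulmx (- u)); rewrite rmulDr rmulDl -DU /D.
  by rewrite subrK subrKC.
(* The blocks of [U] provide [u] (up to sign), [v] and [w]; [z] is read off [g], the lower right
   block being unrestricted. *)
exists (- \matrix_(k, l) U (inl k) (inl l)), (fun k j => U (inl k) (inr j)),
  (fun i k => U (inr i) (inl k)), (fun i j => mxof g (m + i)%N (m + j)%N).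
have gij i j : glmx g i j = mxof g i j by [].
apply/funext; apply: (@split_at m) => i; apply/funext; apply: (@split_at m) => j.
- rewrite block_ul gij gE rcD rone_ord mulmxN mulNmx opprK [RHS]mxE; congr (_ + _).
  rewrite mul_Y0l mxE; apply: eq_bigr => l _; congr (_ * _).
  by rewrite xcol_mulu mxE; apply: eq_bigr => a _; rewrite mxE.
- rewrite block_ur gij gE rcD roneE ltn_eqF ?add0r ?ltn_addr //.
  by rewrite mul_Y0r xcol_mulu.
- rewrite block_dl gij gE rcD roneE gtn_eqF ?add0r ?ltn_addr //.
  by rewrite mul_Y0l; apply: eq_bigr => l _; rewrite xcol_muld.
- by rewrite block_dr.
Qed.

(** [bul] depends on the kernels alone, which gives the independence of the choice of [b] and
    [c]. *)
Lemma form_bul (g : GLinf R) :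
  Gbullet_form b c g <-> bul (ker_infseq b) (ker_infseq c^T) (mxof g).
Proof.
rewrite formP; apply: iff_sym.
refine (@bulP R (ker_infseq b) (ker_infseq c^T) ('I_N + nat)%type X0 Y0
  (ann_xcol (b := b)) _ _ _ (mxof g)).
- by rewrite rtrK; exact: ann_xcol.
- by move=> K X /(ann_factor da)[U [-> _ _]]; exists U.
- move=> K Y /(ann_factor da)[U [YU _ _]]; exists (rtr U).
  by rewrite -rtr_mul -YU rtrK.
Qed.

End FormP.

(** * Finitely generated submodules as kernels *)

(** The columns of [b] are all the solutions of [E x = 0], finitely many as the ring is finite, with
    0 in the remaining places; the double annihilator property of [E^T] identifies the kernel with
    the row span of [E]. *)
Lemma Zp_kernel_presentation n (n1 : (1 < n)%N) k m (E : 'M['Z_n]_(k, m)) :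
  exists b : 'M['Z_n]_(m, #|{: 'cV['Z_n]_m}|),
    forall v : 'rV_m, v *m b = 0 <-> exists a : 'rV_k, v = a *m E.
Proof.
exists (\matrix_(i, j) (if E *m enum_val j == 0 then (enum_val j : 'cV_m) i 0 else 0)).
move=> v; split=> [vb|[a ->]].
  have [|z zE] := Zp_mx_double_ann (b := E^T) (x := v^T) n1.
    move=> w wE; have Ew : E *m w^T = 0 by rewrite -[E]trmxK -trmx_mul wE trmx0.
    rewrite -[LHS]trmxK trmx_mul trmxK; suff -> : v *m w^T = 0 by rewrite trmx0.
    apply/rowP => i; rewrite !ord1 mxE.
    have /rowP/(_ (enum_rank w^T)) := vb; rewrite !mxE => v0.
    by rewrite -[RHS]v0; apply: eq_bigr => l _; rewrite !mxE enum_rankK Ew eqxx mxE.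
  by exists z^T; rewrite -[v]trmxK zE trmx_mul trmxK.
apply/rowP => j; rewrite -mulmxA [RHS]mxE; set x := enum_val j.
have Ex0 : E *m (if E *m x == 0 then x else 0) = 0.
  by case: eqP => [->//|_]; rewrite mulmx0.
transitivity ((a *m (E *m (if E *m x == 0 then x else 0))) 0 0); last first.
  by rewrite Ex0 mulmx0 mxE.
rewrite !mxE; apply: eq_bigr => l _; congr (_ * _); rewrite !mxE.
apply: eq_bigr => i _; rewrite mxE -/x; congr (_ * _).
by case: ifP => // _; rewrite mxE.
Qed.

(** * Finite index and minimality *)

Section Core.
Variables (G : groupType) (H K : set G).
Hypotheses (subH : is_subgroup H) (subK : is_subgroup K).
Hypothesis finH : finite_set [set left_coset H x | x in K].

(** The intersection of the conjugates of [H] by elements of [K], that is, the normal core of [H] in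
    [K]. *)
Definition core_in (x : G) := forall y, K y -> H (y^-1 * x * y)%g.

(** Left translation by [x n] permutes the finitely many cosets; two of the [x n] induce the same
    permutation, so their quotient stabilizes every coset. *)
Lemma core_pigeon (x : nat -> G) : (forall n, K (x n)) ->
  exists a b, a != b /\ core_in ((x a)^-1 * x b)%g.
Proof.
have [H1 HM HV] := subH; have [K1 KM KV] := subK.
move=> Kx; have /finite_seqP[s sE] := finH.
have inS y : K y -> left_coset H y \in s.
  by move=> Ky; have : [set` s] (left_coset H y) by rewrite -sE; exists y.
(* The index [size s], returned for sets outside the list, accounts for the successor in the
   type. *)
pose tr n (i : 'I_(size s)) : 'I_(size s).+1 :=
  inord (index [set (x n * z)%g | z in nth set0 s i] s).
pose f (n : 'I_#|{ffun 'I_(size s) -> 'I_(size s).+1}|.+1) := [ffun i => tr n i].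
have [/injectiveP/leq_card|] := boolP (injectiveb f); first by rewrite card_ord ltnn.
move=> /injectivePn[a [b ab fab]]; exists (val a), (val b).
split; first by rewrite (inj_eq val_inj).
have trans n y : K y -> [set (x n * z)%g | z in left_coset H y] = left_coset H (x n * y)%g.
  move=> Ky; apply/seteqP; split=> [_ [_ [h Hh <-] <-]|_ [h Hh <-]].
    by exists h; rewrite ?mulgA.
  by exists (y * h)%g; [exists h|rewrite mulgA].
move=> y Ky; have ys : (index (left_coset H y) s < size s)%N by rewrite index_mem inS.
have /ffunP/(_ (Ordinal ys)) := fab; rewrite !ffunE /tr /= nth_index ?inS //.
rewrite !trans // => /(congr1 val); rewrite /= !inordK ?ltnS ?index_size // => E.
have {}E : left_coset H (x a * y)%g = left_coset H (x b * y)%g.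
  by rewrite -[LHS](nth_index set0 (inS _ _)) ?E ?nth_index ?inS //; apply: KM.
have [h Hh xh] : left_coset H (x a * y)%g (x b * y)%g.
  by rewrite E; exists 1%g; rewrite ?mulg1.
suff -> : (y^-1 * ((x a)^-1 * x b) * y)%g = h by [].
by rewrite -!mulgA -xh -!mulgA mulKg mulKg.
Qed.

End Core.

Section Main.
Variable n : nat.
Hypothesis n1 : (1 < n)%N.
Local Notation R := 'Z_n.
Variables (L M : set (infseq R)) (half : R).
Hypothesis halfE : half + half = 1.

Lemma da_Zp : double_annihilator R.
Proof. by move=> m k b x; apply: Zp_mx_double_ann. Qed.

Lemma fg_ker m k (e : 'I_k -> infseq R) (P : set (infseq R)) :
  (forall i j, (m <= j)%N -> e i j = 0) ->
  P = [set v | exists a : 'I_k -> R, v = fun j => \sum_i a i * e i j] ->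
  exists b : 'M[R]_(m, #|{: 'cV[R]_m}|), ker_infseq b = P.
Proof.
move=> em ->; have [b bP] := Zp_kernel_presentation n1 (\matrix_(i < k, j < m) e i j).
exists b; apply/seteqP; split=> [_ [v /= /bP[a va] <-]|_ [a ->]].
  exists (a 0); apply/funext; apply: (@split_at m) => j.
    rewrite rv_infseq_ord va mxE; apply: eq_bigr => i _; by rewrite mxE.
  rewrite rv_infseq_out ?leq_addr // big1 // => i _.
  by rewrite em ?mulr0 // leq_addr.
exists (\row_j \sum_i a i * e i j).
  apply/bP; exists (\row_i a i); apply/rowP => j; rewrite !mxE.
  by apply: eq_bigr => i _; rewrite !mxE.
apply/funext; apply: (@split_at m) => j; first by rewrite rv_infseq_ord mxE.
rewrite rv_infseq_out ?leq_addr // big1 // => i _.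
by rewrite em ?mulr0 // leq_addr.
Qed.

Lemma fg_bound k (e : 'I_k -> infseq R) : (forall i, finsupp (e i)) ->
  exists m, forall i j, (m <= j)%N -> e i j = 0.
Proof.
move=> fe; have /choice[t tP] : forall i, exists t, forall j, (t <= j)%N -> e i j = 0.
  by move=> i; apply: finsupp_bound.
exists (\max_i t i)%N => i j mj; apply: tP; apply: leq_trans mj.
exact: leq_bigmax.
Qed.

Lemma presentation : fg_submodule L -> fg_submodule M ->
  exists m N (b : 'M[R]_(m, N)) (c : 'M[R]_(N, m)),
    ker_infseq b = L /\ ker_infseq c^T = M.
Proof.
move=> [k [e [fe LE]]] [k' [e' [fe' ME]]].
have [m1 m1P] := fg_bound fe; have [m2 m2P] := fg_bound fe'.
have [|b bL] := @fg_ker (maxn m1 m2) k e L _ LE.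
  by move=> i j; rewrite geq_max => /andP[/m1P ->].
have [|c cM] := @fg_ker (maxn m1 m2) k' e' M _ ME.
  by move=> i j; rewrite geq_max => /andP[_ /m2P ->].
by exists (maxn m1 m2), _, b, c^T; rewrite trmxK.
Qed.

Section Presented.
Variables (m N : nat) (b : 'M[R]_(m, N)) (c : 'M[R]_(N, m)).
Hypotheses (bL : ker_infseq b = L) (cM : ker_infseq c^T = M).

Lemma GbulletP g : Gbullet L M g <-> bul L M (mxof g).
Proof.
split=> [[m' [N' [b' [c' [bL' cM' fg]]]]]|].
  by rewrite -bL' -cM'; apply/(form_bul _ _ da_Zp).
by rewrite -bL -cM => /(form_bul _ _ da_Zp) fg; exists m, N, b, c; rewrite bL cM.
Qed.

Let Lm l k : L l -> (m <= k)%N -> l k = 0.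
Proof. by rewrite -bL; apply: ker_infseq_bound. Qed.
Let Mm l k : M l -> (m <= k)%N -> l k = 0.
Proof. by rewrite -cM; apply: ker_infseq_bound. Qed.
Let Lf l : L l -> finsupp l.
Proof. by move=> Ll; apply: (@bound_finsupp _ m) => k; apply: Lm. Qed.
Let Mf l : M l -> finsupp l.
Proof. by move=> Ml; apply: (@bound_finsupp _ m) => k; apply: Mm. Qed.

Let X0 := xcol b.
Let Y0 := rtr (xcol c^T).
Let LX0 : ann L X0. Proof. by rewrite -bL; apply: ann_xcol. Qed.
Let MY0 : ann M (rtr Y0). Proof. by rewrite -cM rtrK; apply: ann_xcol. Qed.
Let genX (K : choiceType) (X : rcmx R nat K) : ann L X -> exists U, X = X0 ** U.
Proof. by rewrite -bL => /(ann_factor da_Zp)[U [-> _ _]]; exists U. Qed.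
Let genY (K : choiceType) (Y : rcmx R K nat) : ann M (rtr Y) -> exists U, Y = U ** Y0.
Proof.
rewrite -cM => /(ann_factor da_Zp)[U [YU _ _]]; exists (rtr U).
by rewrite -rtr_mul -YU rtrK.
Qed.

Let bul_mul A B := @bulM R L M ('I_N + nat)%type X0 Y0 LX0 MY0 genX genY A B.
Let bul_inv A A' := @bulV R L M ('I_N + nat)%type X0 Y0 LX0 MY0 genX genY A A'.
Let bul_one := @bul1 R L M ('I_N + nat)%type X0 Y0 LX0 MY0 genX genY.

Lemma Gbullet_subgroup : is_subgroup (Gbullet L M).
Proof.
split.
- by apply/GbulletP; rewrite mxof1; apply: bul_one.
- by move=> x y /GbulletP bx /GbulletP hy; apply/GbulletP; rewrite mxof_mul; apply: bul_mul.
- by move=> x /GbulletP bx; apply/GbulletP; apply: bul_inv bx (mxof_inv x).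
Qed.

Lemma Ghat_subgroup : is_subgroup (Ghat L M).
Proof.
have st1 (P : set (infseq R)) : stable P rone by move=> l; rewrite rmul1r.
have stM (P : set (infseq R)) A B : stable P A -> stable P B -> stable P (A ** B).
  by move=> SA SB l Pl; rewrite rmulA; apply/SB/SA.
split.
- by apply/(GhatP _ Lf Mf); rewrite invg1 mxof1 rtr1.
- move=> x y /(GhatP _ Lf Mf)[a1 a2 a3 a4] /(GhatP _ Lf Mf)[b1 b2 b3 b4].
  by apply/(GhatP _ Lf Mf); rewrite invgM !mxof_mul !rtr_mul; split; apply: stM.
- move=> x /(GhatP _ Lf Mf)[a1 a2 a3 a4]; apply/(GhatP _ Lf Mf).
  by rewrite invgK.
Qed.

Lemma bul_fix A (l : rcmx R unit nat) : bul L M A ->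
  (L (l tt) -> l ** A = l) /\ (M (l tt) -> l ** rtr A = l).
Proof.
move=> [K [X [Y [LX MY ->]]]]; split=> [Ll|Ml].
  by rewrite rmulDr rmul1r rmulA LX // rmul0l addr0.
by rewrite rtrD rtr1 rtr_mul rmulDr rmul1r rmulA MY // rmul0l addr0.
Qed.

Lemma Gbullet_sub : Gbullet L M `<=` Ghat L M.
Proof.
move=> g /GbulletP bg; apply/(GhatP _ Lf Mf).
have bg' := bul_inv bg (mxof_inv g).
split=> l Pl; [have [+ _] := bul_fix l bg|have [+ _] := bul_fix l bg'
  |have [_ +] := bul_fix l bg|have [_ +] := bul_fix l bg']; by move/(_ Pl) ->.
Qed.

Definition corner (g : GLinf R) : 'M[R]_m := \matrix_(i, j) mxof g i j.

(* The parts of [g] off the corner are annihilated by [L] and [M]. *)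
Lemma Ghat_corner g h : Ghat L M g -> Ghat L M h -> corner g = corner h ->
  Gbullet L M (g^-1 * h)%g.
Proof.
move=> /(GhatP _ Lf Mf)[g1 g2 g3 g4] /(GhatP _ Lf Mf)[h1 h2 h3 h4] gh.
have D0 (i j : 'I_m) : mxof h i j = mxof g i j.
  by move/matrixP/(_ i j): gh; rewrite !mxE.
(* Beyond [m], [l A] and [l B] lie in [P] and vanish; below [m], only the corners contribute, and
   they cancel. *)
have annD0 (P : set (infseq R)) (A B : rcmx R nat nat) :
    (forall l k, P l -> (m <= k)%N -> l k = 0) -> stable P A -> stable P B ->
    (forall i j : 'I_m, A i j = B i j) -> ann P (A - B).
  move=> Pm PA PB AB l Pl; apply: rcmxP => -[]; apply: (@split_at m) => j; last first.
    by rewrite rmulBr rcB (Pm _ _ (PA _ Pl)) ?leq_addr // (Pm _ _ (PB _ Pl)) ?leq_addr // subrr.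
  rewrite (@rowvec_mulE _ m) => [|k]; last exact: Pm.
  by rewrite big1 // => i _; rewrite rcB AB subrr mulr0.
have [gg' g'g] := mxof_inv g.
have [|||U DU] := @corner0_factor _ m N b c (mxof h - mxof g) da_Zp.
- by rewrite bL; apply: annD0.
- by rewrite cM rtrD rtrN; exact: (annD0 M _ _ Mm h3 g3 (fun i j => D0 j i)).
- move=> i j im jm; rewrite rcB.
  by rewrite (D0 (Ordinal im) (Ordinal jm)) subrr.
(* [L] is stable under the inverse of [g], hence annihilates [g^-1 X0]. *)
apply/GbulletP; exists ('I_N + nat)%type, (mxof g^-1%g ** X0), (U ** Y0); split.
- by move=> l Ll; rewrite rmulA LX0 //; apply: g2.
- by rewrite rtr_mul; apply: annM.
- rewrite mxof_mul rmulA -(rmulA _ X0) -rmulA -DU rmulBr g'g.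
  by rewrite subrKC.
Qed.

Lemma Gbullet_finite_index : finite_index_subgroup (Gbullet L M) (Ghat L M).
Proof.
split; [exact: Gbullet_subgroup|exact: Gbullet_sub|].
have [B1 BM BV] := Gbullet_subgroup.
(* Each coset is recovered from the corner of any representative; [set0] stands for corners that do
   not occur. *)
pose F (K : 'M[R]_m) : set (GLinf R) :=
  if pselect (exists g, Ghat L M g /\ corner g = K) is left e
  then left_coset (Gbullet L M) (projT1 (cid e)) else set0.
apply: (@sub_finite_set _ _ [set F K | K in [set: 'M[R]_m]]); last first.
  by apply: finite_image; apply: finite_finset.
move=> _ [g Gg <-]; exists (corner g) => //; rewrite /F.
case: pselect => [e|]; last by case; exists g.
case: (cid e) => /= h [Gh hg]; apply/seteqP; split=> _ [k Bk <-].
  exists (g^-1 * h * k)%g; first by apply: BM => //; apply: Ghat_corner.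
  by rewrite !mulgA mulgV mul1g.
exists (h^-1 * g * k)%g; first by apply: BM => //; apply: Ghat_corner.
by rewrite !mulgA mulgV mul1g.
Qed.

(** The normal core of [H] in the stabilizer is a [small_normal] family of matrices, so [all_in]
    puts every [g] of G^bullet into it. *)
Lemma Gbullet_minimal H : finite_index_subgroup H (Ghat L M) -> Gbullet L M `<=` H.
Proof.
move=> [subH HK finH] g /GbulletP bg.
have [H1 HM HV] := subH; have [K1 KM KV] := Ghat_subgroup.
pose P (A : rcmx R nat nat) := exists x, mxof x = A /\ core_in H (Ghat L M) x.
have nP : small_normal (bul L M) P.
  split.
  - move=> _ _ [x [<- Px]] [y [<- Py]]; exists (x * y)%g; split; first exact: mxof_mul.
    move=> z Kz; rewrite (_ : _ * _ = (z^-1 * x * z) * (z^-1 * y * z))%g.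
      by apply: HM; [apply: Px|apply: Py].
    by rewrite !mulgA mulgK.
  - move=> _ A' [x [<- Px]] [xA A'x]; exists x^-1%g; split.
      have [xx' _] := mxof_inv x.
      by rewrite -[LHS]rmul1l -A'x -rmulA xx' rmul1r.
    move=> z Kz; rewrite (_ : _ * _ = (z^-1 * x * z)^-1)%g.
      by apply/HV/Px.
    by rewrite !invgM invgK mulgA.
  - move=> _ B B' [x [<- Px]] iB bB; have [y [yB yB']] := mxof_surj iB.
    exists (y * x * y^-1)%g; rewrite !mxof_mul yB yB'; split=> // z Kz.
    have Ky : Ghat L M y by apply/Gbullet_sub/GbulletP; rewrite yB.
    have := Px (y^-1 * z)%g (KM _ _ (KV _ Ky) Kz).
    by rewrite invgM invgK !mulgA.
  - move=> x x' xx' bx.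
    have /choice[y yP] : forall k, exists y, mxof y = x k /\ mxof y^-1%g = x' k.
      by move=> k; apply: mxof_surj.
    have [|a [d [ad Pad]]] := core_pigeon subH Ghat_subgroup finH (x := y).
      by move=> k; apply/Gbullet_sub/GbulletP; rewrite (yP k).1.
    exists a, d; split=> //; exists ((y a)^-1 * y d)%g; split=> //.
    by rewrite mxof_mul (yP a).2 (yP d).1.
have [s [sI sm sg sg']] := sparse_seq m (mxof g) (mxof g^-1%g).
have [x [/mxof_inj -> Px]] := all_in halfE Lm Mm nP sI sm bul_mul bg (mxof_inv g) sg sg'.
by have := Px _ K1; rewrite invg1 mul1g mulg1.
Qed.

End Presented.
End Main.

Theorem proposition1p4 (p mu : nat) (p_prime : prime p) (p_gt2 : (2 < p)%N)
    (mu_gt0 : (1 <= mu)%N) (L M : set (infseq 'Z_(p ^ mu)))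
    (fgL : fg_submodule L) (fgM : fg_submodule M) :
  minimal_finite_index_subgroup (Gbullet L M) (Ghat L M).
Proof.
have n1 : (1 < p ^ mu)%N by rewrite -(exp1n mu) ltn_exp2r // prime_gt1.
have [m [N [b [c [bL cM]]]]] := presentation n1 fgL fgM.
(* [p ^ mu] is odd, so [(p ^ mu + 1) / 2] is an integer and inverts 2. *)
have halfE : ((p ^ mu).+1./2)%:R + ((p ^ mu).+1./2)%:R = 1 :> 'Z_(p ^ mu).
  rewrite -natrD addnn; have op : odd (p ^ mu).
    by rewrite oddX; case: (even_prime p_prime) => [p2|->]; [rewrite p2 in p_gt2|rewrite orbT].
  have -> : ((p ^ mu).+1./2.*2 = (p ^ mu).+1)%N.
    by rewrite -[RHS]odd_double_half /= op.
  by rewrite -natr1 pchar_Zp ?add0r.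
split=> [|H]; first exact: (Gbullet_finite_index n1 bL cM).
exact: (Gbullet_minimal n1 halfE bL cM).
Qed.
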